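(* Let $\gamma\in(1/2,1)$ and let $x:[0,T]\to\mathbb R^{1,d}$ and $\tilde x^1$ satisfy: $x$ is $\gamma$-Hölder continuous, $\tilde x^1\in\tilde{\mathcal C}^\gamma_{2,\gamma}(\mathbb R^{1,d})$ and $\tilde\delta\tilde x^1=0$. Let $z:[0,T]\to\mathbb R^{d,m}$ be $\gamma$-Hölder continuous, and set, for $\xi\ge0$, $$\mathcal J(\tilde dx\,z)(\xi)=\tilde x^1(\xi)z+\tilde\Lambda[\tilde x^1\delta z](\xi),$$ i.e. $\mathcal J_{ts}(\tilde dx\,z)=\tilde x^1_{ts}z_s+\tilde\Lambda[h]_{ts}$ with $h_{tus}=\tilde x^1_{tu}(z_u-z_s)$. Then: (1) $\mathcal J(\tilde dx\,z)$ is well defined as an element of $\tilde{\mathcal C}^\gamma_{2,\gamma}$, and, when $x$ is a smooth path with $\tilde x^1_{ts}(\xi)=\int_s^te^{-\xi(t-v)}dx_v$ (and $z$ smooth), $\mathcal J_{ts}(\tilde dx\,z)(\xi)=\int_s^te^{-\xi(t-v)}dx_v\,z_v$ (Riemann integral). (2) There is a constant $c_x>0$ such that for all $\ell_1<\ell_2$ in $[0,T]$, $$\mathcal N[\mathcal J(\tilde dx\,z);\tilde{\mathcal C}^\gamma_{2,\gamma}([\ell_1,\ell_2])]\le c_x\{\mathcal N[z;\mathcal C_1^0([\ell_1,\ell_2])]+\varepsilon^\gamma\mathcal N[z;\mathcal C_1^\gamma([\ell_1,\ell_2])]\},\quad \varepsilon=|\ell_2-\ell_1|.$$ (3) For any $\ell_1\le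 s<t\le\ell_2$, $\mathcal J_{ts}(\tilde dx\,z)=\lim\sum_{i=0}^{n}e^{-\cdot(t-t_{i+1})}\tilde x^1_{t_{i+1}t_i}z_{t_i}$ in $\mathcal L_\gamma$, the limit being taken over partitions $s=t_0<t_1<\dots<t_{n+1}=t$ whose mesh tends to $0$.
   Context: Measurable $\hat\phi:(0,\infty)\to\mathbb R$ is fixed. For $\beta>0$ and a finite-dimensional normed space $V$, $\mathcal L_\beta(V)$ is the space of measurable $g:[0,\infty)\to V$ with $\mathcal N[g;\mathcal L_\beta]=\int_0^\infty|\hat\phi(\xi)|(1+\xi^\beta)\|g(\xi)\|d\xi<\infty$. For an interval $J=[\ell_1,\ell_2]$, $\tilde{\mathcal C}_{k,\beta}(J;V)$ is the set of continuous maps from $\{(t_1,\dots,t_k)\in J^k:t_1\ge\dots\ge t_k\}$ to $\mathcal L_\beta(V)$. Put $a_{ts}(\xi)=e^{-\xi(t-s)}-1$; $(\tilde\delta f)_{ts}(\xi)=f_t(\xi)-e^{-\xi(t-s)}f_s(\xi)$, $(\tilde\delta B)_{tus}(\xi)=B_{ts}(\xi)-B_{tu}(\xi)-e^{-\xi(t-u)}B_{us}(\xi)$. Norms: $\mathcal N[B;\tilde{\mathcal C}^\mu_{2,\beta}(J)]=\sup_{s<t}\mathcal N[B_{ts};\mathcal L_\beta]/|t-s|^\mu$; for three-parameter $h$, $\mathcal N[h;\tilde{\mathcal C}^\mu_{3,\beta}]=\inf\sum_i\sup_{s<u<t}\mathcal N[h^i_{tus};\mathcal L_\beta]|t-u|^{-\rho_i}|u-s|^{-(\mu-\rho_i)}$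 over decompositions $h=\sum_ih^i$, $\rho_i\in(0,\mu)$. Spaces $\tilde{\mathcal C}^\mu_{k,\beta}$: finite norm. For paths $z$: $\mathcal N[z;\mathcal C_1^0]=\sup\|z_s\|$, $\mathcal N[z;\mathcal C_1^\gamma]=\sup_{s\ne t}\|z_t-z_s\|/|t-s|^\gamma$. $\tilde\Lambda$ denotes the convolutional sewing map: for $\mu>1$ and $\tilde h\in\tilde{\mathcal C}^\mu_{3,\beta}$ of the form $\tilde\delta B$, $\tilde\Lambda\tilde h$ is the unique element of $\tilde{\mathcal C}^\mu_{2,\beta}$ with $\tilde\delta\tilde\Lambda\tilde h=\tilde h$. In (3), $e^{-\cdot(t-t_{i+1})}$ denotes the function $\xi\mapsto e^{-\xi(t-t_{i+1})}$. *)

(* Defs.v *)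
(* R : realType, Lebesgue integral, matrices with
   the library (max-entry) norm as the finite-dimensional normed spaces. *)
From HB Require Import structures.
From mathcomp Require Import all_boot all_order all_algebra.
From mathcomp Require Import all_classical all_reals all_analysis.
From Stdlib Require Import ClassicalEpsilon.
Set Implicit Arguments. Unset Strict Implicit. Unset Printing Implicit Defensive.
Import Order.TTheory GRing.Theory Num.Theory.
Import numFieldNormedType.Exports.
Local Open Scope classical_set_scope.
Local Open Scope ring_scope.

Section Defs.
Variable R : realType.
Variable phi : R -> R.

(* Elements of L_beta(R^{a,b}) are functions of xi. *)
Definition fsub a b (f g : R -> 'M[R]_(a,b)) : R -> 'M[R]_(a,b) :=
  fun xi => f xi - g xi.

Definition NL (beta : R) a b (g : R -> 'M[R]_(a,b)) : \bar R :=
  (\int[lebesgue_measure]_(xi in (`]0%R, +oo[ : set R))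
     ((`|phi xi| * (1 + xi `^ beta) * `|g xi|)%:E))%E.

Definition inL (beta : R) a b (g : R -> 'M[R]_(a,b)) : Prop :=
  (forall i j, measurable_fun (`[0%R, +oo[ : set R) (fun xi => g xi i j)) /\
  (NL beta g < +oo)%E.

Definition cont2 (beta l1 l2 : R) a b (B : R -> R -> R -> 'M[R]_(a,b)) : Prop :=
  (forall t s, l1 <= s -> s <= t -> t <= l2 -> inL beta (B t s)) /\
  (forall t s, l1 <= s -> s <= t -> t <= l2 ->
   forall e : R, 0 < e -> exists2 del : R, 0 < del &
     forall t' s', l1 <= s' -> s' <= t' -> t' <= l2 ->
       `|t' - t| < del -> `|s' - s| < del ->
       (NL beta (fsub (B t' s') (B t s)) < e%:E)%E).

Definition cont3 (beta l1 l2 : R) a b (h : R -> R -> R -> R -> 'M[R]_(a,b)) : Prop :=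
  (forall t u s, l1 <= s -> s <= u -> u <= t -> t <= l2 -> inL beta (h t u s)) /\
  (forall t u s, l1 <= s -> s <= u -> u <= t -> t <= l2 ->
   forall e : R, 0 < e -> exists2 del : R, 0 < del &
     forall t' u' s', l1 <= s' -> s' <= u' -> u' <= t' -> t' <= l2 ->
       `|t' - t| < del -> `|u' - u| < del -> `|s' - s| < del ->
       (NL beta (fsub (h t' u' s') (h t u s)) < e%:E)%E).

Definition N2 (beta mu l1 l2 : R) a b (B : R -> R -> R -> 'M[R]_(a,b)) : \bar R :=
  ereal_sup [set r | exists t s, [/\ l1 <= s, s < t, t <= l2 &
     r = (NL beta (B t s) * ((t - s) `^ mu)^-1%:E)%E]].

Definition inC2 (beta mu l1 l2 : R) a b (B : R -> R -> R -> 'M[R]_(a,b)) : Prop :=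
  cont2 beta l1 l2 B /\ (N2 beta mu l1 l2 B < +oo)%E.

(* sup term of one piece h^i with exponent rho_i *)
Definition N3piece (beta mu l1 l2 : R) a b
   (p : (R -> R -> R -> R -> 'M[R]_(a,b)) * R) : \bar R :=
  ereal_sup [set r | exists t u s, [/\ l1 <= s, s < u, u < t, t <= l2 &
     r = (NL beta (p.1 t u s) *
          (((t - u) `^ p.2)^-1 * ((u - s) `^ (mu - p.2))^-1)%:E)%E]].

(* N[h; C^mu_{3,beta}(J)]: infimum over finite decompositions h = sum_i h^i
   (equality as elements of L_beta) with rho_i in (0, mu) *)
Definition N3 (beta mu l1 l2 : R) a b (h : R -> R -> R -> R -> 'M[R]_(a,b)) : \bar R :=
  ereal_inf [set r | exists l : seq ((R -> R -> R -> R -> 'M[R]_(a,b)) * R),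
     [/\ all (fun p => (0 < p.2) && (p.2 < mu)) l,
         (forall t u s, l1 <= s -> s <= u -> u <= t -> t <= l2 ->
            NL beta (fsub (h t u s)
              (fun xi => \sum_(p <- l) p.1 t u s xi)) = 0%E) &
         r = (\sum_(p <- l) N3piece beta mu l1 l2 p)%E]].

Definition inC3 (beta mu l1 l2 : R) a b (h : R -> R -> R -> R -> 'M[R]_(a,b)) : Prop :=
  cont3 beta l1 l2 h /\ (N3 beta mu l1 l2 h < +oo)%E.

Definition ecv (xi r : R) : R := expR (- (xi * r)).

Definition dlt2 a b (B : R -> R -> R -> 'M[R]_(a,b)) : R -> R -> R -> R -> 'M[R]_(a,b) :=
  fun t u s xi => B t s xi - B t u xi - ecv xi (t - u) *: B u s xi.

Definition sew_dom (beta mu l1 l2 : R) a b (h : R -> R -> R -> R -> 'M[R]_(a,b)) : Prop :=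
  inC3 beta mu l1 l2 h /\
  exists B, cont2 beta l1 l2 B /\
    (forall t u s, l1 <= s -> s <= u -> u <= t -> t <= l2 ->
       NL beta (fsub (dlt2 B t u s) (h t u s)) = 0%E).

(* the convolutional sewing map: an (the, up to L_beta-null functions)
   element M of C^mu_{2,beta}(J) with tilde-delta M = h in L_beta *)
Definition sew_spec (beta mu l1 l2 : R) a b (h : R -> R -> R -> R -> 'M[R]_(a,b))
   (M : R -> R -> R -> 'M[R]_(a,b)) : Prop :=
  inC2 beta mu l1 l2 M /\
  (forall t u s, l1 <= s -> s <= u -> u <= t -> t <= l2 ->
     NL beta (fsub (dlt2 M t u s) (h t u s)) = 0%E).

Definition sew (beta mu l1 l2 : R) a b (h : R -> R -> R -> R -> 'M[R]_(a,b))
  : R -> R -> R -> 'M[R]_(a,b) :=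
  epsilon (inhabits (fun _ _ _ => 0)) (sew_spec beta mu l1 l2 h).

End Defs.

Definition Csup (R : realType) a b (l1 l2 : R) (z : R -> 'M[R]_(a,b)) : \bar R :=
  ereal_sup [set r | exists s, [/\ l1 <= s, s <= l2 & r = (`|z s|)%:E]].

Definition Chol (R : realType) a b (gam l1 l2 : R) (z : R -> 'M[R]_(a,b)) : \bar R :=
  ereal_sup [set r | exists t s, [/\ l1 <= s <= l2, l1 <= t <= l2, s != t &
     r = (`|z t - z s| / `|t - s| `^ gam)%:E]].

(* entrywise (Lebesgue = Riemann for continuous integrands) integral over [s,t] *)
Definition Mint (R : realType) a b (s t : R) (F : R -> 'M[R]_(a,b)) : 'M[R]_(a,b) :=
  \matrix_(i, j) Rintegral lebesgue_measure (`[s, t] : set R) (fun v => F v i j).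

Definition hterm (R : realType) d m (x1 : R -> R -> R -> 'M[R]_(1,d))
  (z : R -> 'M[R]_(d,m)) : R -> R -> R -> R -> 'M[R]_(1,m) :=
  fun t u s xi => x1 t u xi *m (z u - z s).

Definition Jint (R : realType) (phi : R -> R) d m (gam T : R)
  (x1 : R -> R -> R -> 'M[R]_(1,d)) (z : R -> 'M[R]_(d,m)) : R -> R -> R -> 'M[R]_(1,m) :=
  fun t s xi => x1 t s xi *m z s
                + sew phi gam (2 * gam) 0 T (hterm x1 z) t s xi.

Definition Jsum (R : realType) d m (x1 : R -> R -> R -> 'M[R]_(1,d))
  (z : R -> 'M[R]_(d,m)) (t : R) (n : nat) (p : nat -> R) : R -> 'M[R]_(1,m) :=
  fun xi => \sum_(i < n.+1) ecv xi (t - p i.+1) *: (x1 (p i.+1) (p i) xi *m z (p i)).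

(* Main.v *)
Require Import Defs.
From HB Require Import structures.
From mathcomp Require Import all_boot all_order all_algebra.
From mathcomp Require Import all_classical all_reals all_analysis.
From mathcomp Require Import measurable_realfun ring lra.
Import Order.TTheory GRing.Theory Num.Theory.
Import numFieldNormedType.Exports.
Local Open Scope classical_set_scope.
Local Open Scope ring_scope.
Set Implicit Arguments. Unset Strict Implicit. Unset Printing Implicit Defensive.

(** With A_ts = x1_ts z_s, the relation delta x1 = 0 gives delta A = - h, where
    |h_tus| <= C (t - s)^(2 gam) and 2 gam > 1. Hence the Riemann sums of A
    along the dyadic grids of [0, T], clipped to [s, t], form a geometric
    Cauchy sequence in the weighted L1 space; their limit J is additive and
    M = J - A satisfies delta M = h. A midpoint-splitting argument shows that
    any solution M of delta M = h bounded by K (t - s)^nu, nu > 1, is bounded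
    by a multiple of the Hoelder norm of z on [s, t] times (t - s)^(2 gam).
    The bound (2) follows, and so does (3), because J_ts minus a Riemann sum
    telescopes to a sum of terms exp(-xi (t - t_(i+1))) M over the cells. In
    the smooth case the Riemann sums also converge pointwise in xi to the
    classical integral, which Fatou's lemma identifies with J. *)

(** [sew] picks an element of [sew_spec] by choice on the whole of [0, T], so nothing of its
    construction survives: each estimate must hold for every M that meets the specification. The
    only size information contained there is a finite norm on [0, T], whose value involves all of z,
    whereas (2) allows only the norms of z on [l1, l2]. Hence the bound on M has to come from the
    equation for the triples inside [l1, l2], together with an a priori bound of exponent above 1
    whose constant disappears. The excess 2 e of the exponent 1 + 2 e = 2 gam is spent in two
    halves. In a sum over cells, a factor mesh^e gives convergence and (t - s)^(1 + e) remains. The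
    limit thus first comes with exponent gam + 1/2, which is above 1, and the coboundary equation
    then restores 2 gam. Membership in C_2 also requires joint continuity in (t, s) for the weighted
    norm. It is proved for J, whose additivity reduces it to the single path t -> J_t0, and passes
    to M = J - A because A is continuous. *)

Lemma mxnorm_le (R : realType) a b (M : 'M[R]_(a, b)) (c : R) :
  0 <= c -> (forall i j, `|M i j| <= c) -> `|M| <= c.
Proof.
move=> c0 Mc; rewrite [`|M|]mx_normrE.
by elim/big_ind : _ => // x y xc yc; rewrite ge_max xc yc.
Qed.

Lemma mxnorm_entry (R : realType) a b (M : 'M[R]_(a, b)) i j :
  `|M i j| <= `|M|.
Proof.
by rewrite [X in _ <= X]mx_normrE; exact: (le_bigmax _ (fun ij => `|M ij.1 ij.2|) (i, j)).
Qed.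

(** The max-entry norm is not submultiplicative: an entry of the product is a sum of b products.
    This is where the factors d in the later constants come from. *)
Lemma mxnorm_mul (R : realType) a b c (M : 'M[R]_(a, b)) (N : 'M[R]_(b, c)) :
  `|M *m N| <= b%:R * `|N| * `|M|.
Proof.
apply: mxnorm_le => [|i j]; first by rewrite !mulr_ge0.
rewrite mxE (le_trans (ler_norm_sum _ _ _))//.
rewrite -mulrA mulr_natl -[X in _ *+ X](card_ord b) -sumr_const.
apply: ler_sum => k _; rewrite normrM mulrC.
by rewrite ler_pM// mxnorm_entry.
Qed.

(** Locked, so that unification does not open the integral. Since [fine] sends +oo to 0, the value
    is informative only together with [inL], which is why the estimates below carry membership
    along. *)
HB.lock Definition Lnrm (R : realType) (phi : R -> R) (beta : R) a b
  (g : R -> 'M[R]_(a, b)) : R := fine (NL phi beta g).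

(** * The weighted L1 seminorm and its comparison rules *)

Section Weighted_L1.
Variables (R : realType) (phi : R -> R) (beta : R).
Hypothesis phi_meas : measurable_fun (`]0%R, +oo[ : set R) phi.
Local Notation D := (`]0%R, +oo[%classic : set R).
Local Notation mu := (@lebesgue_measure R).

Local Notation Lnrm := (Lnrm phi beta).

Definition wgt (xi : R) : R := `|phi xi| * (1 + xi `^ beta).

Lemma wgt_ge0 xi : 0 <= wgt xi.
Proof. by rewrite mulr_ge0// addr_ge0// powR_ge0. Qed.

Definition mxmeas a b (g : R -> 'M[R]_(a, b)) :=
  forall i j, measurable_fun (`[0%R, +oo[ : set R) (fun xi => g xi i j).

Lemma measurable_wgt : measurable_fun D wgt.
Proof.
apply: measurable_funM; first by apply: measurableT_comp.
apply: measurable_funD => //; apply: measurable_funTS; exact: measurable_powR.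
Qed.

Lemma measurable_mxnorm a b (g : R -> 'M[R]_(a, b)) :
  mxmeas g -> measurable_fun D (fun xi => `|g xi|).
Proof.
move=> mg.
rewrite (_ : (fun xi => _) =
  (fun xi => \big[Num.max/0]_(ij : 'I_a * 'I_b) `|g xi ij.1 ij.2|)); last first.
  by apply/funext => xi; rewrite [LHS]mx_normrE.
elim: (index_enum _) => [|ij s IH].
  rewrite (_ : (fun xi => _) = cst 0); first exact: measurable_cst.
  by apply/funext => xi; rewrite big_nil.
rewrite (_ : (fun xi => _) = (fun xi => Num.max `|g xi ij.1 ij.2|
    (\big[Num.max/0]_(ij <- s) `|g xi ij.1 ij.2|))); last first.
  by apply/funext => xi; rewrite big_cons.
apply: measurable_maxr => //; apply: measurableT_comp => //.
apply: measurable_funS (mg ij.1 ij.2) => //.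
by apply/subset_itvr; rewrite bnd_simp.
Qed.

Lemma measurable_wgt_mxnorm a b (g : R -> 'M[R]_(a, b)) :
  mxmeas g -> measurable_fun D (fun xi => (wgt xi * `|g xi|)%:E).
Proof.
move=> mg; apply/measurable_EFinP; apply: measurable_funM.
  exact: measurable_wgt.
exact: measurable_mxnorm.
Qed.

Lemma mxmeasD a b (f g : R -> 'M[R]_(a, b)) :
  mxmeas f -> mxmeas g -> mxmeas (fun xi => f xi + g xi).
Proof.
move=> mf mg i j; apply: (eq_measurable_fun (fun xi => f xi i j + g xi i j)).
  by move=> xi _; rewrite mxE.
exact: measurable_funD.
Qed.

Lemma mxmeasZ a b (k : R -> R) (g : R -> 'M[R]_(a, b)) :
  measurable_fun (`[0%R, +oo[%classic : set R) k -> mxmeas g ->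
  mxmeas (fun xi => k xi *: g xi).
Proof.
move=> mk mg i j; apply: (eq_measurable_fun (fun xi => k xi * g xi i j)).
  by move=> xi _; rewrite mxE.
exact: measurable_funM.
Qed.

Lemma mxmeasN a b (g : R -> 'M[R]_(a, b)) :
  mxmeas g -> mxmeas (fun xi => - g xi).
Proof.
move=> mg i j; apply: (eq_measurable_fun (fun xi => - g xi i j)).
  by move=> xi _; rewrite mxE.
exact: measurableT_comp.
Qed.

Lemma mxmeasB a b (f g : R -> 'M[R]_(a, b)) :
  mxmeas f -> mxmeas g -> mxmeas (fun xi => f xi - g xi).
Proof. by move=> mf mg; apply: mxmeasD => //; exact: mxmeasN. Qed.

Lemma mxmeas_mulmx a b c (g : R -> 'M[R]_(a, b)) (Z : 'M[R]_(b, c)) :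
  mxmeas g -> mxmeas (fun xi => g xi *m Z).
Proof.
move=> mg i j; apply: (eq_measurable_fun (fun xi => \sum_k g xi i k * Z k j)).
  by move=> xi _; rewrite mxE.
by apply: measurable_sum => k; apply: measurable_funM.
Qed.

Lemma measurable_ecv (r : R) (A : set R) : measurable_fun A (fun xi => ecv xi r).
Proof.
apply: measurable_funTS; apply: measurableT_comp => //.
by apply: measurableT_comp => //; apply: measurable_funM.
Qed.

Lemma wnorm_ge0 a b (g : R -> 'M[R]_(a, b)) xi :
  (0 <= (wgt xi * `|g xi|)%:E)%E.
Proof. by rewrite lee_fin mulr_ge0// wgt_ge0. Qed.

Lemma NL_ge0 a b (g : R -> 'M[R]_(a, b)) : (0 <= NL phi beta g)%E.
Proof.
by apply: integral_ge0 => xi _; exact: wnorm_ge0.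
Qed.

Lemma Lnrm_ge0 a b (g : R -> 'M[R]_(a, b)) : 0 <= Lnrm g.
Proof. by rewrite unlock fine_ge0// NL_ge0. Qed.

Lemma NLE a b (g : R -> 'M[R]_(a, b)) :
  inL phi beta g -> NL phi beta g = (Lnrm g)%:E.
Proof. by move=> [_ ?]; rewrite unlock fineK// ge0_fin_numE// NL_ge0. Qed.

Lemma NL_eq0 a b (g : R -> 'M[R]_(a, b)) : NL phi beta g = 0%E -> Lnrm g = 0.
Proof. by rewrite unlock => ->. Qed.

Lemma inL_meas a b (g : R -> 'M[R]_(a, b)) : inL phi beta g -> mxmeas g.
Proof. by case. Qed.

(** The one comparison behind the triangle inequality, the contraction by [ecv] and the product
    bound. The three matrix formats are independent because multiplication by z changes the format,
    and domination is asked for xi > 0 only, where exp(-xi r) <= 1. *)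
Lemma Lnrm_le_lin a b a1 b1 a2 b2 (h : R -> 'M[R]_(a, b))
    (f : R -> 'M[R]_(a1, b1)) (g : R -> 'M[R]_(a2, b2)) (c d : R) :
  inL phi beta f -> inL phi beta g -> mxmeas h -> 0 <= c -> 0 <= d ->
  (forall xi, 0 < xi -> `|h xi| <= c * `|f xi| + d * `|g xi|) ->
  inL phi beta h /\ Lnrm h <= c * Lnrm f + d * Lnrm g.
Proof.
move=> Lf Lg mh c0 d0 hfg.
have [mf _] := Lf; have [mg _] := Lg.
have NLh : (NL phi beta h <= (c * Lnrm f + d * Lnrm g)%:E)%E.
  rewrite EFinD !EFinM -!NLE//.
  rewrite -ge0_integralZl ?lee_fin//; last 2 first.
  - exact: measurable_wgt_mxnorm.
  - by move=> xi _; exact: wnorm_ge0.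
  rewrite -ge0_integralZl ?lee_fin//; last 2 first.
  - exact: measurable_wgt_mxnorm.
  - by move=> xi _; exact: wnorm_ge0.
  rewrite -ge0_integralD//; last 4 first.
  - by move=> xi _; apply: mule_ge0; [rewrite lee_fin|exact: wnorm_ge0].
  - by apply: measurable_funeM; exact: measurable_wgt_mxnorm.
  - by move=> xi _; apply: mule_ge0; [rewrite lee_fin|exact: wnorm_ge0].
  - by apply: measurable_funeM; exact: measurable_wgt_mxnorm.
  apply: ge0_le_integral => //.
  - by move=> xi _; exact: wnorm_ge0.
  - exact: measurable_wgt_mxnorm.
  - apply: emeasurable_funD;
      by apply: measurable_funeM; exact: measurable_wgt_mxnorm.
  move=> xi; rewrite /= in_itv/= andbT => xi0; rewrite -!EFinM -EFinD lee_fin.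
  apply: (@le_trans _ _ (wgt xi * (c * `|f xi| + d * `|g xi|))).
    by rewrite ler_wpM2l ?wgt_ge0// hfg.
  by rewrite le_eqVlt; apply/orP; left; apply/eqP; rewrite /wgt; ring.
have Lh : inL phi beta h by split => //; rewrite (le_lt_trans NLh)// ltry.
by split => //; rewrite -lee_fin -NLE.
Qed.


Lemma Lnrm_leD a b a1 b1 a2 b2 (h : R -> 'M[R]_(a, b))
    (f : R -> 'M[R]_(a1, b1)) (g : R -> 'M[R]_(a2, b2)) :
  inL phi beta f -> inL phi beta g -> mxmeas h ->
  (forall xi, 0 < xi -> `|h xi| <= `|f xi| + `|g xi|) ->
  inL phi beta h /\ Lnrm h <= Lnrm f + Lnrm g.
Proof.
move=> Lf Lg mh hfg.
rewrite -[Lnrm f]mul1r -[Lnrm g]mul1r.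
by apply: Lnrm_le_lin => // xi xi0; rewrite !mul1r hfg.
Qed.

Lemma Lnrm_leZ a b a1 b1 (h : R -> 'M[R]_(a, b)) (f : R -> 'M[R]_(a1, b1)) (c : R) :
  inL phi beta f -> mxmeas h -> 0 <= c ->
  (forall xi, 0 < xi -> `|h xi| <= c * `|f xi|) ->
  inL phi beta h /\ Lnrm h <= c * Lnrm f.
Proof.
move=> Lf mh c0 hf.
rewrite -[c * Lnrm f]addr0 -(mul0r (Lnrm f)).
by apply: Lnrm_le_lin => // xi xi0; rewrite mul0r addr0 hf.
Qed.

Section closure.
Variables a b : nat.
Implicit Types f g : R -> 'M[R]_(a, b).

Lemma inLD f g : inL phi beta f -> inL phi beta g ->
  inL phi beta (fun xi => f xi + g xi).
Proof.
move=> Lf Lg; apply: (Lnrm_leD Lf Lg _ _).1; first exact: mxmeasD Lf.1 Lg.1.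
by move=> xi _; exact: ler_normD.
Qed.

Lemma LnrmD f g : inL phi beta f -> inL phi beta g ->
  Lnrm (fun xi => f xi + g xi) <= Lnrm f + Lnrm g.
Proof.
move=> Lf Lg; apply: (Lnrm_leD Lf Lg _ _).2; first exact: mxmeasD Lf.1 Lg.1.
by move=> xi _; exact: ler_normD.
Qed.

Lemma inLB f g : inL phi beta f -> inL phi beta g ->
  inL phi beta (fun xi => f xi - g xi).
Proof.
move=> Lf Lg; apply: (Lnrm_leD Lf Lg _ _).1; first exact: mxmeasB Lf.1 Lg.1.
by move=> xi _; exact: ler_normB.
Qed.

Lemma LnrmB f g : inL phi beta f -> inL phi beta g ->
  Lnrm (fun xi => f xi - g xi) <= Lnrm f + Lnrm g.
Proof.
move=> Lf Lg; apply: (Lnrm_leD Lf Lg _ _).2; first exact: mxmeasB Lf.1 Lg.1.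
by move=> xi _; exact: ler_normB.
Qed.

Lemma NL_ext f g : (forall xi, 0 < xi -> `|f xi| = `|g xi|) ->
  NL phi beta f = NL phi beta g.
Proof.
move=> fg; apply: eq_integral => xi; rewrite inE/= in_itv/= andbT => xi0.
by rewrite fg.
Qed.

Lemma Lnrm_ext f g : (forall xi, 0 < xi -> `|f xi| = `|g xi|) -> Lnrm f = Lnrm g.
Proof. by move=> fg; rewrite unlock (NL_ext fg). Qed.

Lemma LnrmC f g : Lnrm (fun xi => f xi - g xi) = Lnrm (fun xi => g xi - f xi).
Proof. by apply: Lnrm_ext => xi _; rewrite distrC. Qed.

Lemma Lnrm_triB f g h : inL phi beta f -> inL phi beta g -> inL phi beta h ->
  Lnrm (fun xi => f xi - g xi) <=
  Lnrm (fun xi => f xi - h xi) + Lnrm (fun xi => h xi - g xi).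
Proof.
move=> Lf Lg Lh.
rewrite (_ : (fun xi => f xi - g xi) =
  (fun xi => (f xi - h xi) + (h xi - g xi))); last first.
  by apply/funext => xi; rewrite addrA subrK.
by apply: LnrmD; exact: inLB.
Qed.

Lemma NL_cst0 : NL phi beta (fun=> 0 : 'M[R]_(a, b)) = 0%E.
Proof.
by rewrite /NL integral0_eq// => xi _; rewrite normr0 mulr0.
Qed.

Lemma inL0 : inL phi beta (fun=> 0 : 'M[R]_(a, b)).
Proof.
split; last by rewrite NL_cst0.
by move=> i j; rewrite (_ : (fun=> _) = cst 0)//; apply/funext => xi; rewrite mxE.
Qed.

Lemma Lnrm0 : Lnrm (fun=> 0 : 'M[R]_(a, b)) = 0.
Proof. exact/NL_eq0/NL_cst0. Qed.

Lemma inL_sum n (F : nat -> R -> 'M[R]_(a, b)) :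
  (forall i, (i < n)%N -> inL phi beta (F i)) ->
  inL phi beta (fun xi => \sum_(i < n) F i xi).
Proof.
elim: n => [|n IH] LF.
  rewrite (_ : (fun xi => _) = fun=> 0); first exact: inL0.
  by apply/funext => xi; rewrite big_ord0.
rewrite (_ : (fun xi => _) = (fun xi => \sum_(i < n) F i xi + F n xi)).
  by apply: inLD; [apply: IH => i ni; exact/LF/ltnW|exact: LF].
by apply/funext => xi; rewrite big_ord_recr.
Qed.

Lemma Lnrm_sum n (F : nat -> R -> 'M[R]_(a, b)) :
  (forall i, (i < n)%N -> inL phi beta (F i)) ->
  Lnrm (fun xi => \sum_(i < n) F i xi) <= \sum_(i < n) Lnrm (F i).
Proof.
elim: n => [|n IH] LF.
  rewrite big_ord0 (_ : (fun xi => _) = fun=> 0) ?Lnrm0//.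
  by apply/funext => xi; rewrite big_ord0.
rewrite (_ : (fun xi => _) = (fun xi => \sum_(i < n) F i xi + F n xi)).
  rewrite big_ord_recr/=.
  apply: le_trans (LnrmD _ _) _ => //; [|exact: LF|].
    by apply: inL_sum => i ni; exact/LF/ltnW.
  by rewrite lerD2r; apply: IH => i ni; exact/LF/ltnW.
by apply/funext => xi; rewrite big_ord_recr.
Qed.

Lemma ecv_ge0 (xi r : R) : 0 <= ecv xi r.
Proof. exact: expR_ge0. Qed.

Lemma ecv_le1 (xi r : R) : 0 <= xi -> 0 <= r -> ecv xi r <= 1.
Proof. by move=> xi0 r0; rewrite expR_le1 oppr_le0 mulr_ge0. Qed.

Lemma ecvD (xi r s : R) : ecv xi (r + s) = ecv xi r * ecv xi s.
Proof. by rewrite /ecv mulrDr opprD expRD. Qed.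

Lemma ecv0r (xi : R) : ecv xi 0 = 1.
Proof. by rewrite /ecv mulr0 oppr0 expR0. Qed.

(** The semigroup is a contraction, so carrying a term to a later time costs nothing: the sewing
    estimates have the same constants as without the exponential. *)
Lemma inL_ecv r g : 0 <= r -> inL phi beta g ->
  inL phi beta (fun xi => ecv xi r *: g xi) /\
  Lnrm (fun xi => ecv xi r *: g xi) <= Lnrm g.
Proof.
move=> r0 Lg; rewrite -[leRHS]mul1r; apply: Lnrm_leZ => //.
  by apply: mxmeasZ Lg.1; exact: measurable_ecv.
move=> xi xi0; rewrite normrZ ler_wpM2r// ger0_norm ?ecv_ge0// ecv_le1//.
exact: ltW.
Qed.

Lemma inL_mulmx c g (Z : 'M[R]_(b, c)) : inL phi beta g ->
  inL phi beta (fun xi => g xi *m Z) /\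
  Lnrm (fun xi => g xi *m Z) <= b%:R * `|Z| * Lnrm g.
Proof.
move=> Lg; apply: Lnrm_leZ => //; first exact: mxmeas_mulmx Lg.1.
by move=> xi _; exact: mxnorm_mul.
Qed.

End closure.
End Weighted_L1.

(** * Fatou's lemma and strong continuity of the semigroup *)

Section Weighted_L1_limits.
Variables (R : realType) (phi : R -> R) (beta : R).
Hypothesis phi_meas : measurable_fun (`]0%R, +oo[ : set R) phi.
Variables a b : nat.
Local Notation D := (`]0%R, +oo[%classic : set R).
Local Notation mu := (@lebesgue_measure R).
Local Notation w := (wgt phi beta).
Local Notation Lnrm := (Lnrm phi beta).
Implicit Types f g : R -> 'M[R]_(a, b).

Lemma mxnorm_le_sum (M : 'M[R]_(a, b)) : `|M| <= \sum_i \sum_j `|M i j|.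
Proof.
apply: mxnorm_le => [|i j]; first by do 2 apply: sumr_ge0 => ? _.
rewrite (bigD1 i)//= (bigD1 j)//= -addrA lerDl addr_ge0//.
  by apply: sumr_ge0.
by do 2 apply: sumr_ge0 => ? _.
Qed.

Lemma cvg_mxnorm0 (u : nat -> 'M[R]_(a, b)) :
  (forall i j, (fun n => u n i j) @ \oo --> 0) -> (fun n => `|u n|) @ \oo --> 0.
Proof.
move=> u0; apply: (@squeeze_cvgr _ _ _ _ (cst 0)
    (fun n => \sum_i \sum_j `|u n i j|)).
- by apply: nearW => n; rewrite normr_ge0 mxnorm_le_sum.
- exact: cvg_cst.
- rewrite [X in _ --> X](_ : _ = \sum_(i < a) \sum_(j < b) 0); last first.
    by rewrite big1// => i _; rewrite big1.
  apply: cvg_big; first exact: add_continuous.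
  move=> i _; apply: cvg_big; first exact: add_continuous.
  move=> j _.
  by rewrite -(@normr0 _ R); apply: cvg_norm; exact: u0.
Qed.

(** Convergence is required only where the weight is nonzero: elsewhere the integrand vanishes, and
    summability of weighted increments says nothing about the functions themselves. *)
Lemma NL_fatou g f (F : nat -> R -> 'M[R]_(a, b)) (B : R) :
  mxmeas g -> mxmeas f -> (forall n, mxmeas (F n)) ->
  {ae mu, forall xi, D xi -> w xi != 0 -> (fun n => `|F n xi - f xi|) @ \oo --> 0} ->
  (forall n, (NL phi beta (fsub g (F n)) <= B%:E)%E) ->
  (NL phi beta (fsub g f) <= B%:E)%E.
Proof.
move=> mg mf mF Ff FB.
pose h n xi := (w xi * `|g xi - F n xi|)%:E.
have mh n : measurable_fun D (h n).
  by apply: measurable_wgt_mxnorm => //; exact: mxmeasB.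
have h0 n x : D x -> (0 <= h n x)%E by move=> _; exact: (wnorm_ge0 _ _ (fun xi => g xi - F n xi)).
have mliminf : measurable_fun D (fun x => limn_einf (h ^~ x)).
  apply: measurableT_comp => //.
  by apply: measurable_fun_limn_esup => n; exact: measurableT_comp.
have liminf0 x : D x -> (0 <= limn_einf (h ^~ x))%E.
  move=> Dx; rewrite limn_einf_lim; apply: lime_ge; first exact: is_cvg_einfs.
  by apply: nearW => n; apply: le_ereal_inf_tmp => _ [k _ <-]; exact: h0.
apply: (@le_trans _ _ (\int[mu]_(x in D) limn_einf (h ^~ x)))%E.
  apply: ae_ge0_le_integral => //.
  - by move=> x _; exact: (wnorm_ge0 _ _ (fun xi => g xi - f xi)).
  - by apply: measurable_wgt_mxnorm => //; exact: mxmeasB.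
  move: Ff; apply: filterS; first exact: (ae_filter_ringOfSetsType mu).
  move=> xi Ffxi Dxi.
  suff /cvg_limn_einf_sup[-> _] : h ^~ xi @ \oo --> (w xi * `|g xi - f xi|)%:E by [].
  apply: cvg_EFin; first exact: nearW.
  have [w0|w0] := eqVneq (w xi) 0.
    rewrite w0 mul0r (_ : fine \o _ = cst 0); first exact: cvg_cst.
    by apply/funext => n /=; rewrite w0 mul0r.
  apply: cvgM; first exact: cvg_cst.
  apply/cvgrPdist_le => e e0.
  have /cvgrPdist_le/(_ e e0) := Ffxi Dxi w0.
  apply: filterS => n; rewrite sub0r normrN normr_id; apply: le_trans.
  rewrite (le_trans (ler_dist_dist _ _))//.
  by rewrite opprB addrC addrA subrK.
apply: le_trans; first exact: fatou.
rewrite limn_einf_lim; apply: lime_le; first exact: is_cvg_einfs.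
apply: nearW => n; apply: le_trans (FB n); apply: ereal_inf_lbound.
by exists n => /=.
Qed.

(** Dominated convergence along r = 1 / (n + 1) gives one good n; because 1 - exp(-xi r) increases
    with r, that n settles every smaller r. The threshold depends on g, so later uses must fix g
    before del. *)
Lemma Lnrm_ecv_small g : inL phi beta g -> forall e : R, 0 < e ->
  exists2 del : R, 0 < del & forall r, 0 <= r -> r <= del ->
    Lnrm (fun xi => g xi - ecv xi r *: g xi) < e.
Proof.
move=> Lg e e0.
have inLr r : 0 <= r -> inL phi beta (fun xi => g xi - ecv xi r *: g xi).
  by move=> r0; apply: inLB => //; exact: (inL_ecv _ _ _).1.
pose h n xi := (w xi * `|g xi - ecv xi n.+1%:R^-1 *: g xi|)%:E.
have hE r xi : `|g xi - ecv xi r *: g xi| = `|1 - ecv xi r| * `|g xi|.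
  by rewrite -normrZ scalerBl scale1r.
have hcvg : (\int[mu]_(x in D) h n x)%E @[n --> \oo] --> (\int[mu]_(x in D) (cst 0%E x))%E.
  apply: (@dominated_cvg _ _ _ mu D _ h _ (fun xi => (w xi * `|g xi|)%:E)) => //.
  - move=> n; apply: measurable_wgt_mxnorm => //.
    exact: (inLr _ _).1.
  - move=> xi Dxi; apply: cvg_EFin; first exact: nearW.
    rewrite [X in _ --> X](_ : _ = w xi * (`|1 - 1| * `|g xi|)); last first.
      by rewrite subrr normr0 mul0r mulr0.
    rewrite (_ : fine \o _ = (fun n => w xi * (`|1 - ecv xi n.+1%:R^-1| * `|g xi|))); last first.
      by apply/funext => n /=; rewrite hE.
    apply: cvgM; first exact: cvg_cst.
    apply: cvgM; last exact: cvg_cst.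
    apply: cvg_norm; apply: cvgB; first exact: cvg_cst.
    rewrite -[X in _ --> X](ecv0r xi).
    apply: (@continuous_cvg _ _ _ _ _ _ (fun r => ecv xi r)); last exact: cvg_harmonic.
    apply: (@continuous_comp _ _ _ (fun r => - (xi * r)) expR); last exact: continuous_expR.
    by apply: cvgN; apply: cvgM; [exact: cvg_cst|exact: cvg_id].
  - apply/integrableP; split; first exact: measurable_wgt_mxnorm Lg.1.
    under eq_integral do rewrite gee0_abs ?wnorm_ge0//.
    exact: Lg.2.
  - move=> n xi Dxi; have xi0 : 0 < xi by move: Dxi; rewrite /= in_itv/= andbT.
    rewrite gee0_abs; last exact: (wnorm_ge0 _ _ (fun xi => _ - _ *: g xi)).
    rewrite lee_fin; apply: ler_wpM2l; first exact: wgt_ge0.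
    rewrite hE ler_piMl// ger0_norm ?subr_ge0 ?ecv_le1//; last by rewrite ltW.
    by rewrite lerBlDr lerDl ecv_ge0.
rewrite integral0 in hcvg.
have /fine_cvgP[_] := hcvg.
move=> /cvgrPdist_lt/(_ e e0)[n _ /(_ n (leqnn n))/=].
rewrite sub0r normrN => ne; exists n.+1%:R^-1 => // r r0 rn.
have n0 : 0 <= n.+1%:R^-1 :> R by [].
have ne' : Lnrm (fun xi => g xi - ecv xi n.+1%:R^-1 *: g xi) < e.
  by rewrite unlock; exact: le_lt_trans (ler_norm _) ne.
apply: le_lt_trans ne'.
rewrite -[leRHS]mul1r.
apply: (Lnrm_leZ phi_meas (inLr _ n0) (inLr _ r0).1 ler01 _).2.
move=> xi xi0; rewrite mul1r !hE ler_wpM2r//.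
rewrite !ger0_norm ?subr_ge0 ?ecv_le1 ?(ltW xi0)//.
by rewrite lerB// ler_expR lerN2 ler_wpM2l// ltW.
Qed.

End Weighted_L1_limits.

(** * Completeness along geometric sequences *)

Section Weighted_L1_complete.
Variables (R : realType) (phi : R -> R) (beta : R).
Hypothesis phi_meas : measurable_fun (`]0%R, +oo[ : set R) phi.
Variables a b : nat.
Local Notation D := (`]0%R, +oo[%classic : set R).
Local Notation mu := (@lebesgue_measure R).
Local Notation w := (wgt phi beta).
Local Notation Lnrm := (Lnrm phi beta).

Lemma sum_geometric_le (q : R) n : 0 <= q -> q < 1 ->
  \sum_(i < n) q ^+ i <= (1 - q)^-1.
Proof.
move=> q0 q1.
have q1' : 0 < 1 - q by rewrite subr_gt0.
rewrite -[leRHS]mul1r ler_pdivlMr// mulrC.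
have -> : (1 - q) * (\sum_(i < n) q ^+ i) = 1 - q ^+ n.
  by rewrite -[RHS]opprB subrX1 -mulNr opprB.
by rewrite lerBlDr lerDl exprn_ge0.
Qed.

Variables (F : nat -> R -> 'M[R]_(a, b)) (C q : R).
Hypotheses (C0 : 0 <= C) (q0 : 0 <= q) (q1 : q < 1).
Hypothesis LF : forall n, inL phi beta (F n).
Hypothesis dF : forall n, Lnrm (fun xi => F n.+1 xi - F n xi) <= C * q ^+ n.

Let dFsum m n : Lnrm (fun xi => F n xi - F (n + m)%N xi) <=
  C * q ^+ n * \sum_(i < m) q ^+ i.
Proof.
elim: m => [|m IH].
  rewrite big_ord0 mulr0 addn0 (_ : (fun xi => _) = fun=> 0) ?Lnrm0//.
  by apply/funext => xi; rewrite subrr.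
apply: (le_trans (Lnrm_triB phi_meas (LF n) (LF (n + m.+1)) (LF (n + m)))).
rewrite big_ord_recr/= mulrDr lerD// LnrmC addnS (le_trans (dF _))//.
by rewrite exprD mulrA.
Qed.

Let dFgeo m n : Lnrm (fun xi => F n xi - F (n + m)%N xi) <= C / (1 - q) * q ^+ n.
Proof.
apply: (le_trans (dFsum _ _)); rewrite -mulrA [X in _ <= X]mulrAC -mulrA.
by rewrite !ler_wpM2l ?exprn_ge0// sum_geometric_le.
Qed.

Let f xi : 'M[R]_(a, b) :=
  \matrix_(i, j) fine (limn_esup (fun n => (F n xi i j)%:E)).

Let mf : mxmeas f.
Proof.
move=> i j.
apply: (eq_measurable_fun (fun xi => fine (limn_esup (fun n => (F n xi i j)%:E)))).
  by move=> xi _; rewrite mxE.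
apply: (measurable_comp (F := setT)) => //.
apply: (measurable_fun_limn_esup (f := fun n xi => (F n xi i j)%:E)) => n.
by apply/measurable_EFinP; exact: (LF n).1.
Qed.

Let h n xi := (w xi * `|F n.+1 xi - F n xi|)%:E.

Let h0 n xi : (0 <= h n xi)%E.
Proof. exact: (wnorm_ge0 _ _ (fun xi => F n.+1 xi - F n xi)). Qed.

Let mh n : measurable_fun D (h n).
Proof.
by apply: measurable_wgt_mxnorm => //; apply: mxmeasB; [exact: (LF _).1|exact: (LF _).1].
Qed.

Let sum_ae : {ae mu, forall xi, D xi -> (\sum_(0 <= n <oo) h n xi)%E \is a fin_num}.
Proof.
apply: integrable_ae => //; apply/integrableP; split.
  by apply: (ge0_emeasurable_sum (h := h) (P := xpredT)) => // n x _ _; exact: h0.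
under eq_integral do rewrite gee0_abs ?nneseries_ge0//.
rewrite integral_nneseries//.
apply: (@le_lt_trans _ _ (C / (1 - q))%:E); last exact: ltry.
apply: lime_le; first by apply: is_cvg_nneseries => n _ _; exact: integral_ge0.
apply: nearW => n /=.
have LB i : inL phi beta (fun xi => F i.+1 xi - F i xi) by apply: inLB.
have hE i : (\int[mu]_(x in D) h i x)%E = (Lnrm (fun xi => F i.+1 xi - F i xi))%:E.
  by rewrite -NLE.
under eq_bigr do rewrite hE.
rewrite sumEFin lee_fin big_mkord.
apply: (@le_trans _ _ (\sum_(i < n) C * q ^+ i)); first exact: ler_sum.
by rewrite -mulr_sumr ler_wpM2l// sum_geometric_le.
Qed.

(** After division by the positive weight, the increments of each entry are absolutely summable; the
    entry then converges as a telescoping series, and its upper limit is its limit. *)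
Let cvgF xi : (\sum_(0 <= n <oo) h n xi)%E \is a fin_num -> w xi != 0 ->
  (fun n => `|F n xi - f xi|) @ \oo --> 0.
Proof.
move=> sfin w0; apply: cvg_mxnorm0 => i j.
have wgt0 : 0 < w xi by rewrite lt_neqAle eq_sym w0 wgt_ge0.
pose u n := F n xi i j.
have cu : cvgn u.
  have -> : u = (fun n => u 0%N + series (telescope u) n).
    by apply/funext => n; exact: eq_sum_telescope.
  apply: is_cvgD; first exact: is_cvg_cst.
  apply: normed_cvg; apply: nondecreasing_is_cvgn.
    by apply: nondecreasing_series => k _ _; exact: normr_ge0.
  exists ((w xi)^-1 * fine (\sum_(0 <= n <oo) h n xi)) => _ [n _ <-].
  rewrite mulrC ler_pdivlMr// mulrC -lee_fin fineK// /series/= mulr_sumr.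
  apply: le_trans (nneseries_lim_ge n _) => //.
  rewrite -sumEFin; apply: lee_sum => k _.
  rewrite lee_fin ler_wpM2l ?wgt_ge0//.
  by rewrite (le_trans _ (mxnorm_entry _ i j))// !mxE.
have fE : f xi i j = limn u.
  rewrite mxE (_ : limn_esup _ = (limn u)%:E)//.
  apply: (cvg_limn_einf_sup _).2.
  by apply: cvg_EFin => //; exact: nearW.
rewrite (_ : (fun n => _) = (fun n => u n - limn u)).
  rewrite -(subrr (limn u)); apply: cvgB => //; exact: cvg_cst.
by apply/funext => n; rewrite -fE !mxE.
Qed.

(* The limit is taken entrywise, as an upper limit, so that it is measurable
   even where the sequence diverges; the geometric decay makes the differences
   summable almost everywhere, and Fatou's lemma gives the rate. *)
Lemma Lnrm_complete : exists f : R -> 'M[R]_(a, b), inL phi beta f /\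
  forall n, Lnrm (fun xi => F n xi - f xi) <= C / (1 - q) * q ^+ n.
Proof.
have NLf n : (NL phi beta (fsub (F n) f) <= (C / (1 - q) * q ^+ n)%:E)%E.
  (* For fixed n, the whole tail [F (n + m)] stays within the geometric bound of [F n]; letting m
     grow passes the bound to f. *)
  apply: (NL_fatou phi_meas (F := fun m => F (n + m)%N)) => //.
  - exact: (LF n).1.
  - by move=> m; exact: (LF _).1.
  - move: sum_ae; apply: filterS; first exact: (ae_filter_ringOfSetsType mu).
    move=> xi sfin Dxi w0; have := cvgF (sfin Dxi) w0.
    rewrite -(cvg_shiftn n) (_ : [sequence _]_n = (fun m => `|F (n + m)%N xi - f xi|))//.
    by apply/funext => m; rewrite /= addnC.
  - by move=> m; rewrite NLE ?lee_fin ?dFgeo//; exact: inLB.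
have LB n : inL phi beta (fun xi => F n xi - f xi).
  split; last exact: le_lt_trans (NLf n) (ltry _).
  by apply: mxmeasB => //; exact: (LF n).1.
exists f; split=> [|n]; last by rewrite -lee_fin -(NLE (LB n)); exact: NLf.
rewrite (_ : f = (fun xi => F 0%N xi - (F 0%N xi - f xi))); first exact: inLB.
by apply/funext => xi; rewrite opprB addrC subrK.
Qed.

End Weighted_L1_complete.

(** * Geometric decay and sums of powers over cells *)

Lemma le0_geometric (R : realType) (x c q : R) : 0 <= q -> q < 1 ->
  (forall n, x <= c * q ^+ n) -> x <= 0.
Proof.
move=> q0 q1 xc.
have cq : (fun n => c * q ^+ n) @ \oo --> c * 0.
  apply: cvgM; first exact: cvg_cst.
  by apply: cvg_expr; rewrite ger0_norm.
rewrite mulr0 in cq; rewrite -(cvg_lim _ cq)//.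
by apply: limr_ge; [apply/cvg_ex; exists 0|exact: nearW].
Qed.

Lemma powR_half_lt1 (R : realType) (e : R) : 0 < e -> 2^-1 `^ e < 1 :> R.
Proof.
move=> e0; rewrite [ltRHS](_ : 1 = 1 `^ e); last by rewrite powR1.
by apply: gt0_ltr_powR; rewrite ?nnegrE//; lra.
Qed.

(** For a cell of length x, write x^(1 + 2 e) = x^e x^e x: the first factor is at most del^e, the
    second at most the e-th power of the total length, and the third telescopes. *)
Lemma sum_powR_cells (R : realType) (r : nat -> R) (N : nat) (e del : R) :
  0 < e -> (forall k, (k < N)%N -> r k <= r k.+1) ->
  (forall k, (k < N)%N -> r k.+1 - r k <= del) ->
  \sum_(k < N) (r k.+1 - r k) `^ (1 + 2 * e) <=
    del `^ e * (r N - r 0%N) `^ (1 + e).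
Proof.
move=> e0 rmon rdel.
have rle n m : (n <= m)%N -> (m <= N)%N -> r n <= r m.
  move=> /subnK <-; elim: (m - n)%N => // k IH; rewrite addSn => kN.
  exact: le_trans (IH (ltnW kN)) (rmon _ kN).
set L := r N - r 0%N.
have L0 : 0 <= L by rewrite subr_ge0 rle.
apply: (@le_trans _ _ (\sum_(k < N) del `^ e * L `^ e * (r k.+1 - r k))).
  apply: ler_sum => k _; set x := r k.+1 - r k.
  have x0 : 0 <= x by rewrite subr_ge0 rmon.
  have xL : x <= L by rewrite lerB// rle// ltnW.
  have -> : 1 + 2 * e = e + e + 1 by ring.
  rewrite !powRD ?powRr1//; [|by apply/implyP; lra..].
  rewrite ler_wpM2r// ler_pM ?powR_ge0//.
    by apply: ge0_ler_powR; rewrite ?nnegrE ?(ltW e0)// ?rdel// (le_trans x0)// rdel.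
  by apply: ge0_ler_powR; rewrite ?nnegrE ?(ltW e0).
rewrite -mulr_sumr -(big_mkord xpredT (fun k => r k.+1 - r k)) telescope_sumr//.
rewrite -/L -mulrA ler_wpM2l ?powR_ge0// addrC powRD ?powRr1//.
by apply/implyP; lra.
Qed.

(** * Refining and cutting convolutional Riemann sums *)

Section Sewing.
Variables (R : realType) (phi : R -> R) (beta : R).
Hypothesis phi_meas : measurable_fun (`]0%R, +oo[ : set R) phi.
Variables a b : nat.
Local Notation Lnrm := (Lnrm phi beta).
Local Notation inL := (inL phi beta).

(** At t = u = s the coboundary reduces to - [A t t], so a coboundary that vanishes on the diagonal
    forces [A t t] to be null. *)
Lemma dlt2_diag (A : R -> R -> R -> 'M[R]_(a, b)) (t : R) :
  Lnrm (dlt2 A t t t) = Lnrm (A t t).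
Proof.
apply: Lnrm_ext => xi _.
by rewrite /dlt2 !subrr ecv0r scale1r sub0r normrN.
Qed.

Lemma inL_dlt2 (A : R -> R -> R -> 'M[R]_(a, b)) (t u s : R) : u <= t ->
  inL (A t s) -> inL (A t u) -> inL (A u s) -> inL (dlt2 A t u s).
Proof.
move=> ut Lts Ltu Lus; apply: inLB; first exact: phi_meas.
  exact: inLB.
by apply: (inL_ecv _ _ _).1 => //; rewrite subr_ge0.
Qed.

Lemma Lnrm_dlt2 (A : R -> R -> R -> 'M[R]_(a, b)) (t u s : R) : u <= t ->
  inL (A t s) -> inL (A t u) -> inL (A u s) ->
  Lnrm (dlt2 A t u s) <= Lnrm (A t s) + Lnrm (A t u) + Lnrm (A u s).
Proof.
rewrite -subr_ge0 => ut Lts Ltu Lus.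
have [Le Ne] := inL_ecv phi_meas ut Lus.
apply: (le_trans (LnrmB phi_meas (inLB phi_meas Lts Ltu) Le)).
by rewrite lerD// LnrmB.
Qed.

Variable T : R.
Variables (A : R -> R -> R -> 'M[R]_(a, b)) (C e : R).
Hypotheses (C0 : 0 <= C) (e0 : 0 < e).
Local Notation mu := (1 + 2 * e).
Hypothesis LA : forall t s : R, 0 <= s -> s <= t -> t <= T -> inL (A t s).
Hypothesis dA : forall t u s : R, 0 <= s -> s <= u -> u <= t -> t <= T ->
  Lnrm (dlt2 A t u s) <= C * (t - s) `^ mu.

Let A_diag (t : R) : 0 <= t -> t <= T -> Lnrm (A t t) = 0.
Proof.
have mu0 : 0 < mu by have := e0; lra.
move=> t0 tT; apply/eqP; rewrite eq_le Lnrm_ge0 andbT -dlt2_diag.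
rewrite (le_trans (dA t0 _ _ tT))// subrr powR0 ?mulr0//; exact: lt0r_neq0.
Qed.

Definition psum (t : R) (p : nat -> R) (N : nat) : R -> 'M[R]_(a, b) :=
  fun xi => \sum_(k < N) ecv xi (t - p k.+1) *: A (p k.+1) (p k) xi.

(** Degenerate cells are allowed and all indices are constrained: clipping a grid of [0, T] to
    [s, t] collapses the cells outside [s, t] without renumbering the points. *)
Definition ispart (s t : R) (p : nat -> R) :=
  (forall k, s <= p k <= t) /\ (forall k, p k <= p k.+1).

Let inL_term (s t : R) p k : 0 <= s -> t <= T -> ispart s t p ->
  inL (fun xi => ecv xi (t - p k.+1) *: A (p k.+1) (p k) xi).
Proof.
move=> s0 tT [pst pm].
have /andP[sp pt] := pst k.+1; have /andP[sp' pt'] := pst k.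
apply: (inL_ecv _ _ _).1 => //; first by rewrite subr_ge0.
by apply: LA; rewrite ?(le_trans pt tT)// (le_trans s0 sp').
Qed.

Lemma inL_psum (s t : R) p N : 0 <= s -> t <= T -> ispart s t p -> inL (psum t p N).
Proof.
move=> s0 tT pp.
apply: (@inL_sum _ _ _ phi_meas _ _ N (fun k xi => ecv xi (t - p k.+1) *: A (p k.+1) (p k) xi)).
by move=> k _; exact: inL_term pp.
Qed.

(** Deleting the odd points changes the sum by one coboundary per remaining cell, each carried to
    time t by the contraction. *)
Lemma psum_refine (s t : R) p N : 0 <= s -> t <= T -> ispart s t p ->
  Lnrm (fun xi => psum t p N.*2 xi - psum t (fun k => p k.*2) N xi) <=
  \sum_(k < N) C * (p k.+1.*2 - p k.*2) `^ mu.
Proof.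
move=> s0 tT pp.
have [pst pm] := pp.
pose G k xi := ecv xi (t - p k.+1.*2) *: dlt2 A (p k.*2.+2) (p k.*2.+1) (p k.*2) xi.
have LG k : inL (G k) /\ Lnrm (G k) <= C * (p k.+1.*2 - p k.*2) `^ mu.
  have /andP[h1 h2] := pst k.*2; have /andP[h3 h4] := pst k.*2.+2.
  have h5 := pm k.*2; have h6 := pm k.*2.+1.
  have Ldl : inL (dlt2 A (p k.*2.+2) (p k.*2.+1) (p k.*2)).
    by apply: inL_dlt2 => //; apply: LA; lra.
  have tp : 0 <= t - p k.+1.*2 by rewrite subr_ge0.
  have [L1 N1] := inL_ecv phi_meas tp Ldl.
  split => //; apply: (le_trans N1); apply: dA => //; lra.
rewrite LnrmC (_ : (fun xi => _) = (fun xi => \sum_(k < N) G k xi)).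
  apply: (le_trans (Lnrm_sum phi_meas _)) => [i _|]; first exact: (LG i).1.
  by apply: ler_sum => k _; exact: (LG k).2.
apply/funext => xi; rewrite /psum; elim: N => [|N IH].
  by rewrite !big_ord0 subrr.
rewrite doubleS !big_ord_recr/= -IH /G /dlt2 doubleS.
have -> : ecv xi (t - p N.*2.+1) =
   ecv xi (t - p N.*2.+2) * ecv xi (p N.*2.+2 - p N.*2.+1).
  by rewrite -ecvD; congr ecv; ring.
by apply/matrixP => i j; rewrite !mxE; ring.
Qed.

(** Taking max and min with u at every index avoids locating u in the partition. A cell on one side
    of u only produces a term [A u u], which is null; the cell that straddles u produces one
    coboundary. *)
Lemma psum_split (s u t : R) p N : 0 <= s -> s <= u -> u <= t -> t <= T -> ispart s t p ->
  Lnrm (fun xi => psum t p N xi - psum t (fun k => Num.max u (p k)) N xi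
    - ecv xi (t - u) *: psum u (fun k => Num.min u (p k)) N xi) <=
  \sum_(k < N) C * (p k.+1 - p k) `^ mu.
Proof.
move=> s0 su ut tT [pst pm].
pose G k xi := ecv xi (t - p k.+1) *: A (p k.+1) (p k) xi -
  ecv xi (t - Num.max u (p k.+1)) *:
    A (Num.max u (p k.+1)) (Num.max u (p k)) xi
  - ecv xi (t - u) *: (ecv xi (u - Num.min u (p k.+1)) *:
    A (Num.min u (p k.+1)) (Num.min u (p k)) xi).
have LG k : inL (G k) /\ Lnrm (G k) <= C * (p k.+1 - p k) `^ mu.
  have /andP[h1 h2] := pst k; have /andP[h3 h4] := pst k.+1.
  have h5 := pm k.
  have h0 : 0 <= C * (p k.+1 - p k) `^ mu by rewrite mulr_ge0// powR_ge0.
  have Luu : inL (fun xi => ecv xi (t - u) *: A u u xi) /\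
             Lnrm (fun xi => ecv xi (t - u) *: A u u xi) <= Lnrm (A u u).
    by apply: inL_ecv => //; [lra|apply: LA; lra].
  have outer : G k = (fun xi => - (ecv xi (t - u) *: A u u xi)) ->
      inL (G k) /\ Lnrm (G k) <= C * (p k.+1 - p k) `^ mu.
    move=> ->.
    have [L1 N1] : inL (fun xi => - (ecv xi (t - u) *: A u u xi)) /\
        Lnrm (fun xi => - (ecv xi (t - u) *: A u u xi)) <= 1 * Lnrm (A u u).
      apply: Lnrm_leZ => //; [apply: LA; lra|exact: mxmeasN (inL_meas Luu.1)|].
      move=> xi xi0; rewrite normrN normrZ ler_wpM2r// ger0_norm ?ecv_ge0//.
      by rewrite ecv_le1 ?subr_ge0// ltW.
    by split => //; rewrite (le_trans N1)// A_diag ?mulr0//; lra.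
  have [up|pu] := leP u (p k).
    have up' := le_trans up h5.
    apply: outer; apply/funext => xi; rewrite /G.
    rewrite (max_idPr up) (max_idPr up') (min_idPl up) (min_idPl up').
    by rewrite subrr sub0r subrr ecv0r scale1r.
  have [pu'|up] := leP (p k.+1) u.
    apply: outer; apply/funext => xi; rewrite /G.
    rewrite (max_idPl (ltW pu)) (max_idPl pu') (min_idPr (ltW pu)) (min_idPr pu').
    rewrite scalerA -ecvD (_ : t - u + (u - p k.+1) = t - p k.+1); last by ring.
    by rewrite addrAC subrr sub0r.
  have Ldl : inL (dlt2 A (p k.+1) u (p k)).
    by apply: inL_dlt2 => //; [exact: ltW|apply: LA; lra..].
  have tp : 0 <= t - p k.+1 by rewrite subr_ge0.
  have [L1 N1] := inL_ecv phi_meas tp Ldl.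
  have -> : G k = (fun xi => ecv xi (t - p k.+1) *: dlt2 A (p k.+1) u (p k) xi).
    apply/funext => xi; rewrite /G /dlt2.
    rewrite (max_idPl (ltW pu)) (max_idPr (ltW up)) (min_idPr (ltW pu)) (min_idPl (ltW up)).
    have -> : ecv xi (t - u) = ecv xi (t - p k.+1) * ecv xi (p k.+1 - u).
      by rewrite -ecvD; congr ecv; ring.
    rewrite subrr ecv0r scale1r.
    by apply/matrixP => i j; rewrite !mxE; ring.
  split => //; apply: (le_trans N1); apply: dA => //; lra.
rewrite (_ : (fun xi => _) = (fun xi => \sum_(k < N) G k xi)).
  apply: (le_trans (Lnrm_sum phi_meas _)) => [i _|]; first exact: (LG i).1.
  by apply: ler_sum => k _; exact: (LG k).2.
by apply/funext => xi; rewrite /psum scaler_sumr -!sumrB.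
Qed.
End Sewing.

(** * Dyadic grids of [0, T] clipped to a subinterval *)

Section Grid.
Variable R : realType.
Implicit Types s t u x y T : R.

Definition clip s t x := Num.max s (Num.min t x).

Lemma clip_in s t x : s <= t -> s <= clip s t x <= t.
Proof. by move=> st; rewrite /clip le_max lexx/= ge_max st ge_min lexx. Qed.

Lemma clip_le s t x y : x <= y -> clip s t x <= clip s t y.
Proof.
by rewrite /clip /Num.max /Num.min => xy; repeat case: ifP; lra.
Qed.

Lemma clip_lip s t x y : x <= y -> clip s t y - clip s t x <= y - x.
Proof.
by rewrite /clip /Num.max /Num.min => xy; repeat case: ifP; lra.
Qed.

Lemma max_clip s u t x : s <= u -> Num.max u (clip s t x) = clip u t x.
Proof. by move=> su; rewrite /clip maxA (max_l su). Qed.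

Lemma min_clip s u t x : s <= u -> u <= t -> Num.min u (clip s t x) = clip s u x.
Proof. by move=> su ut; rewrite /clip min_maxr minA (min_l ut) (min_r su). Qed.

Definition grid T n s t k := clip s t (T * k%:R / 2 ^+ n).

Lemma grid0 T n s t : 0 <= s -> s <= t -> grid T n s t 0 = s.
Proof.
move=> s0 st; rewrite /grid mulr0 mul0r /clip.
by rewrite (min_r (le_trans s0 st)) (max_l s0).
Qed.

Lemma gridN T n s t : s <= t -> t <= T -> grid T n s t (2 ^ n) = t.
Proof.
move=> st tT; rewrite /grid natrX mulfK ?expf_neq0// /clip.
by rewrite (min_l tT) (max_r st).
Qed.

Lemma grid_double T n s t k : grid T n.+1 s t k.*2 = grid T n s t k.
Proof.
congr clip; rewrite exprSr -muln2 natrM; field.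
by rewrite expf_neq0.
Qed.

Lemma grid_step T n k : T * k.+1%:R / 2 ^+ n - T * k%:R / 2 ^+ n = T / 2 ^+ n :> R.
Proof. by rewrite -mulrBl -mulrBr -natr1 (addrC k%:R) addrK mulr1. Qed.

Lemma grid_le T n s t k : 0 <= T -> grid T n s t k <= grid T n s t k.+1.
Proof.
move=> T0; apply: clip_le; rewrite -subr_ge0 grid_step.
by rewrite divr_ge0// exprn_ge0.
Qed.

Lemma grid_mesh T n s t k : 0 <= T ->
  grid T n s t k.+1 - grid T n s t k <= T / 2 ^+ n.
Proof.
move=> T0; rewrite -(grid_step T n k); apply: clip_lip.
by rewrite -subr_ge0 grid_step divr_ge0// exprn_ge0.
Qed.

Lemma ispart_grid T n s t : 0 <= T -> s <= t -> ispart s t (grid T n s t).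
Proof. by move=> T0 st; split=> k; [exact: clip_in|exact: grid_le]. Qed.

Lemma powR_mesh T n e : 0 <= T ->
  (T / 2 ^+ n) `^ e = T `^ e * (2^-1 `^ e) ^+ n.
Proof.
move=> T0; rewrite powRM ?invr_ge0 ?exprn_ge0// -exprVn; congr (_ * _).
by rewrite -powR_mulrn ?invr_ge0// powRAC powR_mulrn// powR_ge0.
Qed.

End Grid.

(** * Existence of the additive limit *)

Section Sewing_existence.
Variables (R : realType) (phi : R -> R) (beta : R).
Hypothesis phi_meas : measurable_fun (`]0%R, +oo[ : set R) phi.
Variables a b : nat.
Local Notation Lnrm := (Lnrm phi beta).
Local Notation inL := (inL phi beta).
Variable T : R.
Hypothesis T0 : 0 < T.
Variables (A : R -> R -> R -> 'M[R]_(a, b)) (C e : R).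
Hypotheses (C0 : 0 <= C) (e0 : 0 < e).
Local Notation mu := (1 + 2 * e).
Local Notation q := (2^-1 `^ e : R).
Hypothesis LA : forall t s : R, 0 <= s -> s <= t -> t <= T -> inL (A t s).
Hypothesis dA : forall t u s : R, 0 <= s -> s <= u -> u <= t -> t <= T ->
  Lnrm (dlt2 A t u s) <= C * (t - s) `^ mu.

Let S n t s := psum A t (grid T n s t) (2 ^ n).
Let B (t s : R) := C * T `^ e * (t - s) `^ (1 + e).

Let LS n t s : 0 <= s -> s <= t -> t <= T -> inL (S n t s).
Proof.
move=> s0 st tT.
exact: (inL_psum phi_meas LA _ s0 tT (ispart_grid _ (ltW T0) st)).
Qed.

Let sum_grid n t s : 0 <= s -> s <= t -> t <= T ->
  \sum_(k < 2 ^ n) C * (grid T n s t k.+1 - grid T n s t k) `^ mu <= B t s * q ^+ n.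
Proof.
move=> s0 st tT; rewrite -mulr_sumr /B.
have := @sum_powR_cells R (grid T n s t) (2 ^ n) e (T / 2 ^+ n) e0
  (fun k _ => grid_le _ _ _ _ (ltW T0)) (fun k _ => grid_mesh _ _ _ _ (ltW T0)).
rewrite (grid0 _ _ s0 st) (gridN _ st tT) (powR_mesh _ _ (ltW T0)) => H.
by rewrite -!mulrA ler_wpM2l// (le_trans H)// -mulrA ler_wpM2l ?powR_ge0// mulrC.
Qed.

Let dS n t s : 0 <= s -> s <= t -> t <= T ->
  Lnrm (fun xi => S n.+1 t s xi - S n t s xi) <= B t s * q ^+ n.
Proof.
move=> s0 st tT.
have pp := ispart_grid n.+1 (ltW T0) st.
have := psum_refine phi_meas LA dA (2 ^ n) s0 tT pp.
rewrite -mul2n -expnS (_ : (fun k => grid T n.+1 s t k.*2) = grid T n s t); last first.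
  by apply/funext => k; exact: grid_double.
move=> H; apply: (le_trans H); apply: le_trans (sum_grid n s0 st tT).
by apply: ler_sum => k _; rewrite !grid_double.
Qed.

Let S_split n t u s : 0 <= s -> s <= u -> u <= t -> t <= T ->
  Lnrm (dlt2 (S n) t u s) <= B t s * q ^+ n.
Proof.
move=> s0 su ut tT; have st := le_trans su ut.
have pp := ispart_grid n (ltW T0) st.
have := psum_split phi_meas C0 e0 LA dA (2 ^ n) s0 su ut tT pp.
rewrite (_ : (fun k => Num.max u _) = grid T n u t); last first.
  by apply/funext => k; exact: max_clip.
rewrite (_ : (fun k => Num.min u _) = grid T n s u); last first.
  by apply/funext => k; exact: min_clip.
by move=> H; apply: (le_trans H); exact: sum_grid.
Qed.

(** At level 0 the only cell is [s, t] itself, so the rate of convergence read at n = 0 is already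
    the estimate on J - A. *)
Let S0 t s : 0 <= s -> s <= t -> t <= T -> S 0 t s = A t s.
Proof.
move=> s0 st tT; apply/funext => xi.
rewrite /S /psum expn0 big_ord1 /=.
have := gridN 0 st tT; rewrite expn0 => ->.
by rewrite grid0// subrr ecv0r scale1r.
Qed.

(* Riemann sums along the dyadic grids of [0, T] clipped to [s, t]: clipping at
   an intermediate point u only affects one cell, so that additivity holds in
   the limit. *)
Lemma sewing_limit : exists J : R -> R -> R -> 'M[R]_(a, b),
  [/\ (forall t s : R, 0 <= s -> s <= t -> t <= T -> inL (J t s)),
      (forall t u s : R, 0 <= s -> s <= u -> u <= t -> t <= T ->
         Lnrm (dlt2 J t u s) = 0) &
      exists2 K : R, 0 <= K & forall t s : R, 0 <= s -> s <= t -> t <= T ->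
        Lnrm (fun xi => J t s xi - A t s xi) <= K * (t - s) `^ (1 + e)].
Proof.
have q0 : 0 <= q by exact: powR_ge0.
have q1 : q < 1 by exact: powR_half_lt1.
have q1' : 0 < 1 - q by rewrite subr_gt0.
have B0 t s : 0 <= B t s by rewrite !mulr_ge0// powR_ge0.
(* Outside the simplex 0 <= s <= t <= T the limit receives the dummy value 0. *)
have /choice[J HJ] : forall ts : R * R, exists f : R -> 'M[R]_(a, b),
    0 <= ts.2 -> ts.2 <= ts.1 -> ts.1 <= T -> inL f /\
    forall n, Lnrm (fun xi => S n ts.1 ts.2 xi - f xi) <= B ts.1 ts.2 / (1 - q) * q ^+ n.
  move=> [t s] /=.
  have [s0|] := leP 0 s; last by exists (fun=> 0).
  have [st|] := leP s t; last by exists (fun=> 0).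
  have [tT|] := leP t T; last by exists (fun=> 0).
  have [f [Lf Hf]] := Lnrm_complete phi_meas (B0 t s) q0 q1
    (fun n => LS n s0 st tT) (fun n => dS n s0 st tT).
  by exists f.
have LJ t s : 0 <= s -> s <= t -> t <= T -> inL (J (t, s)).
  by move=> s0 st tT; have [] := HJ (t, s) s0 st tT.
have SJ n t s : 0 <= s -> s <= t -> t <= T ->
    Lnrm (fun xi => S n t s xi - J (t, s) xi) <= B t s / (1 - q) * q ^+ n.
  by move=> s0 st tT; have [_] := HJ (t, s) s0 st tT; exact.
exists (fun t s => J (t, s)); split.
- exact: LJ.
- move=> t u s s0 su ut tT.
  have st := le_trans su ut; have u0 := le_trans s0 su; have uT := le_trans ut tT.
  apply/eqP; rewrite eq_le Lnrm_ge0 andbT.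
  (* The first term bounds the failure of additivity of the level-n sums, the other three the
     distances from the three values of J to their sums. *)
  apply: (le0_geometric (c := B t s +
    (B t s / (1 - q) + B t u / (1 - q) + B u s / (1 - q))) q0 q1) => n.
  pose V t s xi := S n t s xi - J (t, s) xi.
  have LV t' s' : 0 <= s' -> s' <= t' -> t' <= T -> inL (V t' s').
    by move=> *; apply: inLB => //; [exact: LS|exact: LJ].
  have -> : dlt2 (fun t s => J (t, s)) t u s =
      (fun xi => dlt2 (S n) t u s xi - dlt2 V t u s xi).
    apply/funext => xi; rewrite /dlt2 /V.
    by apply/matrixP => i j; rewrite !mxE; ring.
  have LSd : inL (dlt2 (S n) t u s) by apply: inL_dlt2 => //; exact: LS.
  have LVd : inL (dlt2 V t u s) by apply: inL_dlt2 => //; exact: LV.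
  apply: (le_trans (LnrmB phi_meas LSd LVd)).
  rewrite mulrDl lerD//; first exact: S_split.
  apply: (le_trans (Lnrm_dlt2 phi_meas ut (LV _ _ s0 st tT) (LV _ _ u0 ut tT) (LV _ _ s0 su uT))).
  by rewrite !mulrDl !lerD//; exact: SJ.
- exists (C * T `^ e / (1 - q)).
    by rewrite !mulr_ge0 ?powR_ge0// invr_ge0 ltW.
  move=> t s s0 st tT; rewrite LnrmC -(S0 s0 st tT).
  by rewrite (le_trans (SJ 0%N t s s0 st tT))// expr0 mulr1 /B mulrAC.
Qed.

End Sewing_existence.

(** * Removing the a priori constant *)

Section Sewing_bound.
Variables (R : realType) (phi : R -> R) (beta : R).
Hypothesis phi_meas : measurable_fun (`]0%R, +oo[ : set R) phi.
Variables a b : nat.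
Local Notation Lnrm := (Lnrm phi beta).
Local Notation inL := (inL phi beta).

(* Splitting at the midpoint maps an a priori constant K for exponent nu to
   2^(1-nu) K, hence iterating removes it. *)
Lemma sewing_bound (l1 l2 mu nu C K : R) (M : R -> R -> R -> 'M[R]_(a, b)) :
  1 < mu -> 1 < nu ->
  (forall t s : R, l1 <= s -> s < t -> t <= l2 -> inL (M t s)) ->
  (forall t s : R, l1 <= s -> s < t -> t <= l2 ->
     Lnrm (M t s) <= K * (t - s) `^ nu) ->
  (forall t u s : R, l1 <= s -> s < u -> u < t -> t <= l2 ->
     Lnrm (dlt2 M t u s) <= C * (t - s) `^ mu) ->
  forall t s : R, l1 <= s -> s < t -> t <= l2 ->
    Lnrm (M t s) <= C / (1 - 2^-1 `^ (mu - 1)) * (t - s) `^ mu.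
Proof.
move=> mu1 nu1 LM MK dM.
set q := 2^-1 `^ (mu - 1); set p := 2^-1 `^ (nu - 1).
have q1 : q < 1 by apply: powR_half_lt1; rewrite subr_gt0.
have p1 : p < 1 by apply: powR_half_lt1; rewrite subr_gt0.
have p0 : 0 <= p by exact: powR_ge0.
have half (x k : R) : 0 <= x -> 1 < k -> 2 * (x / 2) `^ k = 2^-1 `^ (k - 1) * x `^ k.
  move=> x0 k1; rewrite powRM ?invr_ge0//.
  have -> : 2^-1 `^ k = 2^-1 * 2^-1 `^ (k - 1) :> R.
    by rewrite mulr_powRB1 ?invr_ge0//; lra.
  by field.
(* The constant C / (1 - q) is the fixed point of c -> C + q c, so each halving reproduces it, while
   K picks up a factor p < 1. *)
suff H n (t s : R) : l1 <= s -> s < t -> t <= l2 ->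
    Lnrm (M t s) <= C / (1 - q) * (t - s) `^ mu + K * p ^+ n * (t - s) `^ nu.
  move=> t s ls st tl; rewrite -subr_le0.
  apply: (le0_geometric (c := K * (t - s) `^ nu) p0 p1) => n.
  by rewrite lerBlDl (mulrAC K) H.
elim: n t s => [|n IH] t s ls st tl.
  rewrite expr0 mulr1 (le_trans (MK _ _ ls st tl))// lerDr.
  have C0 : 0 <= C * (t - s) `^ mu.
    have su : s < (s + t) / 2 by lra.
    have ut : (s + t) / 2 < t by lra.
    exact: le_trans (Lnrm_ge0 _ _ _) (dM _ _ _ ls su ut tl).
  by rewrite mulrAC mulr_ge0// invr_ge0 subr_ge0 ltW.
pose u := (s + t) / 2.
have su : s < u by rewrite /u; lra.
have ut : u < t by rewrite /u; lra.
have tuE : t - u = (t - s) / 2 by rewrite /u; field.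
have usE : u - s = (t - s) / 2 by rewrite /u; field.
have Lts := LM t s ls st tl.
have Ltu : inL (M t u) by apply: LM => //; lra.
have Lus : inL (M u s) by apply: LM => //; lra.
have tu0 : 0 <= t - u by rewrite subr_ge0 ltW.
have [Le Ne] := inL_ecv phi_meas tu0 Lus.
have -> : M t s = (fun xi => dlt2 M t u s xi + (M t u xi + ecv xi (t - u) *: M u s xi)).
  by apply/funext => xi; rewrite /dlt2; apply/matrixP => i j; rewrite !mxE; ring.
apply: le_trans (LnrmD phi_meas _ _) _; [|exact: inLD|].
  by apply: inL_dlt2 => //; exact: ltW.
apply: le_trans (lerD (dM t u s ls su ut tl) (LnrmD phi_meas Ltu Le)) _.
have Htu := IH t u (le_trans ls (ltW su)) ut tl.
have Hus := IH u s ls su (le_trans (ltW ut) tl).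
rewrite tuE in Htu; rewrite usE in Hus.
have ts0 : 0 <= t - s by lra.
have hmu := half _ _ ts0 mu1; have hnu := half _ _ ts0 nu1.
rewrite -/q in hmu; rewrite -/p in hnu.
set X := (t - s) `^ mu in hmu *; set Y := (t - s) `^ nu in hnu *.
set X' := ((t - s) / 2) `^ mu in hmu Htu Hus.
set Y' := ((t - s) / 2) `^ nu in hnu Htu Hus.
apply: (@le_trans _ _ (C * X + (C / (1 - q) * (2 * X') + K * p ^+ n * (2 * Y')))).
  by rewrite lerD2l (le_trans (lerD Htu (le_trans Ne Hus)))//; lra.
rewrite hmu hnu exprSr.
rewrite [leLHS](_ : _ = C / (1 - q) * X + K * (p ^+ n * p) * Y)//.
by field; lra.
Qed.

End Sewing_bound.

Lemma powR_small (R : realType) (g c e : R) : 0 < g -> 0 <= c -> 0 < e ->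
  exists2 del : R, 0 < del & forall x : R, 0 <= x -> x <= del -> c * x `^ g < e.
Proof.
move=> g0 c0 e0; have c1 : 0 < c + 1 by lra.
have ec : 0 < e / (c + 1) by rewrite divr_gt0.
exists ((e / (c + 1)) `^ g^-1); first exact: powR_gt0.
move=> x x0 xd; apply: (@le_lt_trans _ _ (c * (e / (c + 1)))).
  rewrite ler_wpM2l//.
  have -> : e / (c + 1) = ((e / (c + 1)) `^ g^-1) `^ g.
    by rewrite -powRrM mulVf ?gt_eqF// powRr1// ltW.
  by apply: ge0_ler_powR; rewrite ?nnegrE ?powR_ge0// ltW.
by rewrite mulrA ltr_pdivrMr// mulrC ltr_pM2l//; lra.
Qed.

(* Unification would otherwise unfold these down to Lebesgue integrals. *)
#[local] Opaque inL NL.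

(** * Joint continuity of additive maps *)

Section Continuity.
Variables (R : realType) (phi : R -> R) (beta : R).
Hypothesis phi_meas : measurable_fun (`]0%R, +oo[ : set R) phi.
Local Notation Lnrm := (Lnrm phi beta).
Local Notation inL := (inL phi beta).

Lemma inL_onem_ecv a b (f : R -> 'M[R]_(a, b)) r : 0 <= r -> inL f ->
  inL (fun xi => f xi - ecv xi r *: f xi) /\
  Lnrm (fun xi => f xi - ecv xi r *: f xi) <= Lnrm f.
Proof.
move=> r0 Lf; rewrite -[leRHS]mul1r; apply: Lnrm_leZ => //.
  by apply: mxmeasB; [exact: inL_meas Lf|exact: inL_meas (inL_ecv phi_meas r0 Lf).1].
move=> xi xi0; rewrite -{1}[f xi]scale1r -scalerBl normrZ ler_wpM2r//.
rewrite ger0_norm ?subr_ge0 ?ecv_le1 ?(ltW xi0)//.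
by rewrite lerBlDr lerDl ecv_ge0.
Qed.

(** Factoring out the exponential at the smaller time compares two transport times through the
    defect at their distance, the quantity that [Lnrm_ecv_small] controls. *)
Lemma ecv_dist (xi r r' : R) : 0 <= xi -> 0 <= r -> 0 <= r' ->
  `|ecv xi r' - ecv xi r| <= 1 - ecv xi `|r' - r|.
Proof.
move=> xi0; wlog rr' : r r' / r <= r'.
  move=> H r0 r'0; have [|/ltW] := leP r r'; first by move=> ?; exact: H.
  by move=> ?; rewrite distrC (distrC r' r); exact: H.
move=> r0 r'0; rewrite (ger0_norm (_ : 0 <= r' - r)) ?subr_ge0//.
have -> : ecv xi r' = ecv xi r * ecv xi (r' - r) by rewrite -ecvD; congr ecv; ring.
rewrite distrC -{1}[ecv xi r]mulr1 -mulrBr normrM (ger0_norm (ecv_ge0 _ _)).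
rewrite ger0_norm ?subr_ge0 ?ecv_le1 ?subr_ge0//.
by rewrite ler_piMl ?ecv_le1// subr_ge0 ecv_le1// subr_ge0.
Qed.

Variables a b : nat.
Implicit Types B J : R -> R -> R -> 'M[R]_(a, b).

Lemma cont2P (l1 l2 : R) B : cont2 phi beta l1 l2 B <->
  (forall t s : R, l1 <= s -> s <= t -> t <= l2 -> inL (B t s)) /\
  (forall t s : R, l1 <= s -> s <= t -> t <= l2 ->
   forall e : R, 0 < e -> exists2 del : R, 0 < del &
     forall t' s' : R, l1 <= s' -> s' <= t' -> t' <= l2 ->
       `|t' - t| < del -> `|s' - s| < del ->
       Lnrm (fun xi => B t' s' xi - B t s xi) < e).
Proof.
split=> -[LB cB]; (split; first exact: LB) => t s ls st tl e e0;
  have [del del0 H] := cB t s ls st tl e e0; exists del => // t' s' ls' st' tl' td sd.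
  rewrite -lte_fin -NLE; first exact: H.
  by apply: inLB => //; exact: LB.
rewrite NLE ?lte_fin; first exact: H.
by apply: inLB => //; exact: LB.
Qed.

Lemma cont2D (l1 l2 : R) B B' : cont2 phi beta l1 l2 B -> cont2 phi beta l1 l2 B' ->
  cont2 phi beta l1 l2 (fun t s xi => B t s xi + B' t s xi).
Proof.
move=> /cont2P[LB cB] /cont2P[LB' cB']; apply/cont2P; split.
  by move=> t s ls st tl; apply: inLD => //; [exact: LB|exact: LB'].
move=> t s ls st tl e e0; have e20 : 0 < e / 2 by rewrite divr_gt0.
have [d1 d10 H1] := cB t s ls st tl _ e20.
have [d2 d20 H2] := cB' t s ls st tl _ e20.
exists (Num.min d1 d2); first by rewrite lt_min d10.
move=> t' s' ls' st' tl'; rewrite !lt_min => /andP[t1 t2] /andP[s1 s2].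
have -> : (fun xi => B t' s' xi + B' t' s' xi - (B t s xi + B' t s xi)) =
  (fun xi => (B t' s' xi - B t s xi) + (B' t' s' xi - B' t s xi)).
  by apply/funext => xi; rewrite opprD addrACA.
apply: le_lt_trans (LnrmD phi_meas _ _) _; [apply: inLB => //; exact: LB|
  apply: inLB => //; exact: LB'|].
have := H1 t' s' ls' st' tl' t1 s1; have := H2 t' s' ls' st' tl' t2 s2.
by lra.
Qed.

Lemma cont2N (l1 l2 : R) B : cont2 phi beta l1 l2 B ->
  cont2 phi beta l1 l2 (fun t s xi => - B t s xi).
Proof.
have NE f : NL phi beta (fun xi => - f xi : 'M[R]_(a, b)) = NL phi beta f.
  by apply: NL_ext => xi _; rewrite normrN.
move=> [LB cB]; split=> [t s ls st tl|t s ls st tl e e0].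
  have [mB fB] := LB t s ls st tl.
  by split; [exact: mxmeasN|rewrite NE].
have [del del0 H] := cB t s ls st tl e e0; exists del => // t' s' ls' st' tl' td sd.
rewrite (_ : fsub _ _ = (fun xi => - fsub (B t' s') (B t s) xi)); first by rewrite NE; exact: H.
by apply/funext => xi; rewrite /fsub opprB opprK addrC.
Qed.

Section additive.
Variables (T g K : R) (J : R -> R -> R -> 'M[R]_(a, b)).
Hypotheses (g0 : 0 < g) (K0 : 0 <= K).
Hypothesis LJ : forall t s : R, 0 <= s -> s <= t -> t <= T -> inL (J t s).
Hypothesis dJ : forall t u s : R, 0 <= s -> s <= u -> u <= t -> t <= T ->
  Lnrm (dlt2 J t u s) = 0.
Hypothesis JK : forall t s : R, 0 <= s -> s <= t -> t <= T ->
  Lnrm (J t s) <= K * (t - s) `^ g.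

(** Additivity at x reduces the increment to [J y x] and the semigroup defect on [J x 0]. Additivity
    at w then splits this defect into one on [J x w], at most the norm of [J x w], and one on
    [J w 0]. *)
Let modulus (w x y : R) : 0 <= w -> w <= x -> x <= y -> y <= T ->
  Lnrm (fun xi => J y 0 xi - J x 0 xi) <= Lnrm (J y x) + Lnrm (J x w) +
    Lnrm (fun xi => J w 0 xi - ecv xi (y - x) *: J w 0 xi).
Proof.
move=> w0 wx xy yT.
have x0 := le_trans w0 wx; have xT := le_trans xy yT; have wT := le_trans wx xT.
have y0 := le_trans x0 xy.
have LI t : 0 <= t -> t <= T -> inL (J t 0) by move=> *; exact: LJ.
have yx0 : 0 <= y - x by rewrite subr_ge0.
have xw0 : 0 <= x - w by rewrite subr_ge0.
have [L1 _] := inL_ecv phi_meas yx0 (LI x x0 xT).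
have [L2 _] := inL_ecv phi_meas xw0 (LI w w0 wT).
have [L3 N3] := inL_onem_ecv yx0 (LI x x0 xT).
have [L4 N4] := inL_onem_ecv yx0 (LJ w0 wx xT).
have [L5 N5] := inL_onem_ecv yx0 (LI w w0 wT).
have [L6 N6] := inL_ecv phi_meas xw0 L5.
have Ld : inL (dlt2 J x w 0) by apply: inL_dlt2 => //; [exact: LI|exact: LJ|exact: LI].
have [L7 N7] := inL_onem_ecv yx0 Ld.
have Ld' : inL (dlt2 J y x 0) by apply: inL_dlt2 => //; [exact: LI|exact: LJ|exact: LI].
have -> : (fun xi => J y 0 xi - J x 0 xi) =
  (fun xi => dlt2 J y x 0 xi + (J y x xi - (J x 0 xi - ecv xi (y - x) *: J x 0 xi))).
  by apply/funext => xi; rewrite /dlt2; apply/matrixP => i j; rewrite !mxE; ring.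
apply: le_trans (LnrmD phi_meas Ld' _) _.
  by apply: inLB => //; exact: LJ.
rewrite dJ// add0r; apply: le_trans (LnrmB phi_meas _ L3) _; first exact: LJ.
rewrite -addrA lerD2l.
rewrite [X in Lnrm X <= _](_ : _ = (fun xi =>
  (dlt2 J x w 0 xi - ecv xi (y - x) *: dlt2 J x w 0 xi) +
  ((J x w xi - ecv xi (y - x) *: J x w xi) +
   ecv xi (x - w) *: (J w 0 xi - ecv xi (y - x) *: J w 0 xi)))); last first.
  by apply/funext => xi; rewrite /dlt2; apply/matrixP => i j; rewrite !mxE; ring.
apply: le_trans (LnrmD phi_meas L7 (inLD phi_meas L4 L6)) _.
rewrite dJ// in N7.
have := LnrmD phi_meas L4 L6; lra.
Qed.

Let contI (t : R) : 0 <= t -> t <= T -> forall e : R, 0 < e ->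
  exists2 del : R, 0 < del & forall t' : R, 0 <= t' -> t' <= T -> `|t' - t| < del ->
    Lnrm (fun xi => J t' 0 xi - J t 0 xi) < e.
Proof.
move=> t0 tT e e0.
have e30 : 0 < e / 3 by rewrite divr_gt0.
have [d1 d10 H1] := powR_small g0 K0 e30.
(* Any t' in [0, T] within d1 / 2 of t lies above w and at most d1 away from it, so the base point
   serves both signs of t' - t and is fixed before d2 is chosen. *)
pose w := Num.max 0 (t - d1 / 2).
have w0 : 0 <= w by rewrite le_max lexx.
have wt : w <= t by rewrite ge_max t0/=; lra.
have wd : t - d1 / 2 <= w by rewrite le_max lexx orbT.
have LIw : inL (J w 0) by apply: LJ => //; exact: le_trans tT.
have [d2 d20 H2] := Lnrm_ecv_small phi_meas LIw e30.
exists (Num.min (d1 / 2) d2); first by rewrite lt_min d20 andbT; lra.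
move=> t' t'0 t'T; rewrite lt_min => /andP[td1 td2].
have main (x y : R) : w <= x -> x <= y -> y <= T -> y - x < d1 / 2 -> y - x < d2 -> x - w <= d1 ->
    Lnrm (fun xi => J y 0 xi - J x 0 xi) < e.
  move=> wx xy yT yx1 yx2 xw.
  have yx0 : 0 <= y - x by rewrite subr_ge0.
  have xT := le_trans xy yT; have x0 := le_trans w0 wx.
  have xw0 : 0 <= x - w by rewrite subr_ge0.
  apply: (le_lt_trans (modulus w0 wx xy yT)).
  have A1 := JK x0 xy yT; have A2 := JK w0 wx xT.
  have yxd : y - x <= d1 by lra.
  have A3 := H1 _ yx0 yxd; have A4 := H1 _ xw0 xw.
  have A5 := H2 _ yx0 (ltW yx2).
  lra.
have [tt'|/ltW t't] := leP t t'.
  rewrite ger0_norm ?subr_ge0// in td1 td2.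
  by apply: main => //; lra.
rewrite LnrmC; rewrite distrC ger0_norm ?subr_ge0// in td1 td2.
apply: main => //; last by lra.
by rewrite ge_max t'0/=; lra.
Qed.

(* Continuity in t of J t 0 from the left needs a base point w < t: the
   contribution of [0, w] is then a fixed element, on which the semigroup is
   strongly continuous. *)
Lemma cont2_additive : cont2 phi beta 0 T J.
Proof.
apply/cont2P; split => // t s s0 st tT e e0.
have sT := le_trans st tT; have t0 := le_trans s0 st.
have e30 : 0 < e / 3 by rewrite divr_gt0.
have [d1 d10 H1] := contI t0 tT e30.
have [d2 d20 H2] := contI s0 sT e30.
have LIs : inL (J s 0) by exact: LJ.
have [d3 d30 H3] := Lnrm_ecv_small phi_meas LIs e30.
exists (Num.min (Num.min d1 d2) (d3 / 2)).
  by rewrite !lt_min d10 d20/= divr_gt0.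
move=> t' s' s'0 st' t'T; rewrite !lt_min => /andP[/andP[td1 _] td3] /andP[/andP[_ sd2] sd3].
have s'T := le_trans st' t'T; have t'0 := le_trans s'0 st'.
have r0 : 0 <= t - s by rewrite subr_ge0.
have r'0 : 0 <= t' - s' by rewrite subr_ge0.
have r'r : `|(t' - s') - (t - s)| <= d3.
  have -> : (t' - s') - (t - s) = (t' - t) - (s' - s) by ring.
  by rewrite (le_trans (ler_normB _ _))//; lra.
have [L1 _] := inL_ecv phi_meas r'0 (LJ (lexx 0) s'0 s'T).
have [L2 _] := inL_ecv phi_meas r0 (LJ (lexx 0) s0 sT).
have [L2' _] := inL_ecv phi_meas r'0 (LJ (lexx 0) s0 sT).
have LIt : inL (J t 0) by exact: LJ.
have LIt' : inL (J t' 0) by exact: LJ.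
have LIs' : inL (J s' 0) by exact: LJ.
have Ld : inL (dlt2 J t s 0) by apply: inL_dlt2 => //; exact: LJ.
have Ld' : inL (dlt2 J t' s' 0) by apply: inL_dlt2 => //; exact: LJ.
have LIss := inLB phi_meas LIs' LIs.
have [L3 N3] := inL_ecv phi_meas r'0 LIss.
have LItt := inLB phi_meas LIt' LIt.
have [L4 N4] := inL_onem_ecv (normr_ge0 ((t' - s') - (t - s))) LIs.
have [L5 N5] : inL (fun xi => ecv xi (t' - s') *: J s 0 xi - ecv xi (t - s) *: J s 0 xi) /\
   Lnrm (fun xi => ecv xi (t' - s') *: J s 0 xi - ecv xi (t - s) *: J s 0 xi) <=
   1 * Lnrm (fun xi => J s 0 xi - ecv xi `|(t' - s') - (t - s)| *: J s 0 xi).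
  apply: Lnrm_leZ => //; first exact: mxmeasB (inL_meas L2') (inL_meas L2).
  move=> xi xi0; rewrite mul1r -scalerBl -[X in _ <= `|X - _|]scale1r -scalerBl !normrZ.
  rewrite ler_wpM2r//.
  by apply: le_trans (ecv_dist _ _ _) (ler_norm _) => //; exact: ltW.
(* Up to null functions, [J t s] is [J t 0] minus [J s 0] carried over the time t - s. Its variation
   consists of the variations of these two values and of the change of transport time on the fixed
   [J s 0], a third of e for each. *)
rewrite (_ : (fun xi => _) = (fun xi => ((J t' 0 xi - J t 0 xi) -
   (ecv xi (t' - s') *: (J s' 0 xi - J s 0 xi) +
    (ecv xi (t' - s') *: J s 0 xi - ecv xi (t - s) *: J s 0 xi)))
   - (dlt2 J t' s' 0 xi - dlt2 J t s 0 xi))); last first.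
  by apply/funext => xi; rewrite /dlt2; apply/matrixP => i j; rewrite !mxE; ring.
have L6 := inLD phi_meas L3 L5.
have A1 := LnrmB phi_meas (inLB phi_meas LItt L6) (inLB phi_meas Ld' Ld).
have A2 := LnrmB phi_meas LItt L6.
have A3 := LnrmD phi_meas L3 L5.
have A4 := LnrmB phi_meas Ld' Ld.
rewrite !dJ// in A4.
have A5 := H1 t' t'0 t'T td1; have A6 := H2 s' s'0 s'T sd2.
have A7 := H3 _ (normr_ge0 _) r'r.
apply: (le_lt_trans A1); lra.
Qed.
End additive.
End Continuity.

(** * Real constants from the extended-valued norms *)

Section Norm_bounds.
Variables (R : realType) (a b : nat).

(** The condition l1 < l2 makes the supremum range over a nonempty set, hence nonnegative; being
    below +oo, it is a real number. *)
Lemma Chol_bound (gam l1 l2 : R) (z : R -> 'M[R]_(a, b)) : l1 < l2 ->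
  (Chol gam l1 l2 z < +oo)%E ->
  exists2 H : R, 0 <= H & Chol gam l1 l2 z = H%:E /\
    forall s t : R, l1 <= s -> s <= l2 -> l1 <= t -> t <= l2 ->
      `|z t - z s| <= H * `|t - s| `^ gam.
Proof.
move=> l12 fin.
have lb (s t : R) : l1 <= s -> s <= l2 -> l1 <= t -> t <= l2 -> s != t ->
    ((`|z t - z s| / `|t - s| `^ gam)%:E <= Chol gam l1 l2 z)%E.
  move=> ls sl lt tl st; apply: ereal_sup_ubound.
  by exists t, s; split => //; rewrite ?ls ?lt.
have ge0 : (0 <= Chol gam l1 l2 z)%E.
  apply: (@le_trans _ _ (`|z l2 - z l1| / `|l2 - l1| `^ gam)%:E).
    by rewrite lee_fin divr_ge0// powR_ge0.
  by apply: lb; rewrite ?lexx ?(ltW l12)// lt_eqF.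
have finE : Chol gam l1 l2 z \is a fin_num by rewrite ge0_fin_numE.
exists (fine (Chol gam l1 l2 z)); first exact: fine_ge0.
rewrite fineK//; split => // s t ls sl lt tl.
have [->|st] := eqVneq s t.
  by rewrite subrr normr0 mulr_ge0 ?powR_ge0// fine_ge0.
have := lb s t ls sl lt tl st.
rewrite -{1}(fineK finE) lee_fin ler_pdivrMr// powR_gt0//.
by rewrite normr_gt0 subr_eq0 eq_sym.
Qed.

Lemma Chol_sub (gam l1 l2 k1 k2 : R) (z : R -> 'M[R]_(a, b)) : l1 <= k1 -> k2 <= l2 ->
  (Chol gam k1 k2 z <= Chol gam l1 l2 z)%E.
Proof.
move=> l1k1 k2l2; apply: ereal_sup_le => _ [t [s [/andP[h1 h2] /andP[h3 h4] st ->]]].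
exists t, s; split => //.
  by rewrite (le_trans l1k1 h1) (le_trans h2 k2l2).
by rewrite (le_trans l1k1 h3) (le_trans h4 k2l2).
Qed.

Variables (phi : R -> R) (beta : R).
Local Notation Lnrm := (Lnrm phi beta).

Lemma N2_le (mu l1 l2 K : R) (B : R -> R -> R -> 'M[R]_(a, b)) :
  (forall t s : R, l1 <= s -> s < t -> t <= l2 -> inL phi beta (B t s)) ->
  (forall t s : R, l1 <= s -> s < t -> t <= l2 -> Lnrm (B t s) <= K * (t - s) `^ mu) ->
  (N2 phi beta mu l1 l2 B <= K%:E)%E.
Proof.
move=> LB BK; apply: ge_ereal_sup => _ [t [s [ls st tl ->]]].
rewrite NLE; last exact: LB.
by rewrite -EFinM lee_fin ler_pdivrMr ?powR_gt0 ?subr_gt0// BK.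
Qed.

Lemma N2_bound (mu l1 l2 : R) (B : R -> R -> R -> 'M[R]_(a, b)) :
  inC2 phi beta mu l1 l2 B ->
  exists2 K : R, 0 <= K & forall t s : R, l1 <= s -> s < t -> t <= l2 ->
    Lnrm (B t s) <= K * (t - s) `^ mu.
Proof.
(* The maximum with 0 covers the supremum of the empty set, which is -oo. *)
move=> [[LB _] fin]; exists (fine (Order.max 0 (N2 phi beta mu l1 l2 B))%E).
  by apply: fine_ge0; rewrite le_max lexx.
move=> t s ls st tl.
have p0 : 0 < (t - s) `^ mu by rewrite powR_gt0 ?subr_gt0.
rewrite -ler_pdivrMr// -lee_fin fineK; last first.
  by rewrite ge0_fin_numE ?le_max ?lexx// gt_max fin andbT.
rewrite le_max; apply/orP; right; apply: ereal_sup_ubound.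
exists t, s; split => //; rewrite NLE ?EFinM//.
by apply: LB => //; exact: ltW.
Qed.

End Norm_bounds.

(** * The convolutional Young integral *)

Section Young.
Variables (R : realType) (phi : R -> R).
Hypothesis phi_meas : measurable_fun (`]0%R, +oo[ : set R) phi.
Variables (d m : nat) (T gam : R).
Hypotheses (T0 : 0 < T) (gam1 : 1 / 2 < gam).
Variable x1 : R -> R -> R -> 'M[R]_(1, d).
Hypothesis Hx1 : inC2 phi gam gam 0 T x1.
Hypothesis Hdx1 : forall t u s : R, 0 <= s -> s <= u -> u <= t -> t <= T ->
  NL phi gam (dlt2 x1 t u s) = 0%E.
Local Notation Lnrm := (Lnrm phi gam).
Local Notation inL := (inL phi gam).

Let gam0 : 0 < gam. Proof. by have := gam1; lra. Qed.

Let Lx1 (t s : R) : 0 <= s -> s <= t -> t <= T -> inL (x1 t s).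
Proof. exact: Hx1.1.1. Qed.

Let dx1 (t u s : R) : 0 <= s -> s <= u -> u <= t -> t <= T -> Lnrm (dlt2 x1 t u s) = 0.
Proof. by move=> *; exact/NL_eq0/Hdx1. Qed.

(** [N2] only sees s < t; on the diagonal, additivity makes [x1 t t] null, so the bound extends to s
    = t. *)
Lemma additive_bound : exists2 K : R, 0 <= K &
  forall t s : R, 0 <= s -> s <= t -> t <= T -> Lnrm (x1 t s) <= K * (t - s) `^ gam.
Proof.
have [K K0 HK] := N2_bound Hx1; exists K => // t s s0.
rewrite le_eqVlt => /orP[/eqP <- sT|st tT]; last exact: HK.
by rewrite -dlt2_diag dx1// mulr_ge0// powR_ge0.
Qed.

Variable K : R.
Hypothesis K0 : 0 <= K.
Hypothesis x1K : forall t s : R, 0 <= s -> s <= t -> t <= T ->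
  Lnrm (x1 t s) <= K * (t - s) `^ gam.

Variable z : R -> 'M[R]_(d, m).
Variable Hz : R.
Hypothesis Hz0 : 0 <= Hz.
Hypothesis zH : forall s t : R, 0 <= s -> s <= T -> 0 <= t -> t <= T ->
  `|z t - z s| <= Hz * `|t - s| `^ gam.

Let A t s xi := x1 t s xi *m z s.
Let h := hterm x1 z.
Let Z := `|z 0| + Hz * T `^ gam.

Let Z0 : 0 <= Z. Proof. by rewrite addr_ge0// mulr_ge0// powR_ge0. Qed.

Let zZ (s : R) : 0 <= s -> s <= T -> `|z s| <= Z.
Proof.
move=> s0 sT; rewrite -[z s](subrK (z 0)) addrC (le_trans (ler_normD _ _))//.
rewrite lerD2l (le_trans (zH (lexx 0) (ltW T0) s0 sT))//.
rewrite ler_wpM2l// subr0 ger0_norm//.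
by apply: ge0_ler_powR; rewrite ?nnegrE// ltW.
Qed.

Lemma holder_cont (s : R) : 0 <= s -> s <= T -> forall e : R, 0 < e ->
  exists2 del : R, 0 < del & forall s' : R, 0 <= s' -> s' <= T -> `|s' - s| < del ->
    `|z s' - z s| < e.
Proof.
move=> s0 sT e e0; have [del del0 H] := powR_small gam0 Hz0 e0.
exists del => // s' s'0 s'T sd.
by rewrite (le_lt_trans (zH s0 sT s'0 s'T))// H// ltW.
Qed.

Lemma inL_riemann (t s : R) : 0 <= s -> s <= t -> t <= T -> inL (A t s).
Proof. by move=> s0 st tT; apply: (inL_mulmx phi_meas (z s) (Lx1 s0 st tT)).1. Qed.

Lemma inL_hterm (t u s : R) : 0 <= s -> s <= u -> u <= t -> t <= T -> inL (h t u s).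
Proof.
move=> s0 su ut tT.
exact: (inL_mulmx phi_meas (z u - z s) (Lx1 (le_trans s0 su) ut tT)).1.
Qed.

(** A Leibniz rule: the sum [dlt2 A] + h equals [dlt2 x1] multiplied by z_s, exactly in xi. It is
    null only in the weighted norm, because additivity of x1 is known only there. *)
Lemma dlt2_riemann (t u s : R) : 0 <= s -> s <= u -> u <= t -> t <= T ->
  inL (fun xi => dlt2 A t u s xi + h t u s xi) /\
  Lnrm (fun xi => dlt2 A t u s xi + h t u s xi) = 0.
Proof.
move=> s0 su ut tT.
have -> : (fun xi => dlt2 A t u s xi + h t u s xi) = (fun xi => dlt2 x1 t u s xi *m z s).
  apply/funext => xi; rewrite /dlt2 /A /h /hterm.
  rewrite mulmxBr !mulmxBl -scalemxAl.
  by apply/matrixP => i j; rewrite !mxE; ring.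
have L : inL (dlt2 x1 t u s).
  by apply: inL_dlt2 => //; apply: Lx1 => //;
    [exact: le_trans ut|exact: le_trans su|exact: le_trans tT].
have [L' N'] := inL_mulmx phi_meas (z s) L; split => //.
apply/eqP; rewrite eq_le Lnrm_ge0 andbT (le_trans N')//.
by rewrite dx1// mulr0.
Qed.

(** H is kept apart from [Hz] so that the Hölder constant of a subinterval can be inserted, as (2)
    demands. The product form is what [N3piece] measures with rho = gam. *)
Lemma hterm_bound2 (H t u s : R) : 0 <= H -> 0 <= s -> s <= u -> u <= t -> t <= T ->
  `|z u - z s| <= H * (u - s) `^ gam ->
  Lnrm (h t u s) <= d%:R * K * H * ((t - u) `^ gam * (u - s) `^ gam).
Proof.
move=> H0 s0 su ut tT zus; have u0 := le_trans s0 su.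
have [_ N] := inL_mulmx phi_meas (z u - z s) (Lx1 u0 ut tT).
apply: (le_trans N); rewrite -!mulrA ler_wpM2l//.
rewrite [leRHS](_ : _ = (H * (u - s) `^ gam) * (K * (t - u) `^ gam)); last by ring.
by apply: ler_pM => //; [exact: Lnrm_ge0|exact: x1K].
Qed.

Lemma hterm_bound (H t u s : R) : 0 <= H -> 0 <= s -> s <= u -> u <= t -> t <= T ->
  `|z u - z s| <= H * (u - s) `^ gam ->
  Lnrm (h t u s) <= d%:R * K * H * (t - s) `^ (2 * gam).
Proof.
move=> H0 s0 su ut tT zus.
apply: (le_trans (hterm_bound2 H0 s0 su ut tT zus)).
rewrite ler_wpM2l ?mulr_ge0//.
have -> : 2 * gam = gam + gam by ring.
rewrite powRD; last by apply/implyP; have := gam0; lra.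
by apply: ler_pM; rewrite ?powR_ge0//; apply: ge0_ler_powR; rewrite ?nnegrE ?(ltW gam0)//; lra.
Qed.

Let zus (u s : R) : 0 <= s -> s <= u -> u <= T -> `|z u - z s| <= Hz * (u - s) `^ gam.
Proof.
move=> s0 su uT; rewrite -[u - s]ger0_norm ?subr_ge0//.
by apply: zH => //; [exact: le_trans uT|exact: le_trans su].
Qed.

Lemma Lnrm_dlt2_riemann (t u s : R) : 0 <= s -> s <= u -> u <= t -> t <= T ->
  Lnrm (dlt2 A t u s) <= d%:R * K * Hz * (t - s) `^ (2 * gam).
Proof.
move=> s0 su ut tT; have [L N] := dlt2_riemann s0 su ut tT.
rewrite (_ : dlt2 A t u s = (fun xi => (dlt2 A t u s xi + h t u s xi) - h t u s xi)); last first.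
  by apply/funext => xi; rewrite addrK.
apply: (le_trans (LnrmB phi_meas L (inL_hterm s0 su ut tT))).
rewrite N add0r hterm_bound// zus//; exact: le_trans tT.
Qed.

Lemma Lnrm_mulmx_dist (f f' : R -> 'M[R]_(1, d)) (X X' : 'M[R]_(d, m)) :
  inL f -> inL f' ->
  Lnrm (fun xi => f' xi *m X' - f xi *m X) <=
  d%:R * `|X'| * Lnrm (fun xi => f' xi - f xi) + d%:R * `|X' - X| * Lnrm f.
Proof.
move=> Lf Lf'.
have [L1 N1] := inL_mulmx phi_meas X' (inLB phi_meas Lf' Lf).
have [L2 N2] := inL_mulmx phi_meas (X' - X) Lf.
rewrite (_ : (fun xi => _) = (fun xi => (f' xi - f xi) *m X' + f xi *m (X' - X))).
  by apply: (le_trans (LnrmD phi_meas L1 L2)); exact: lerD.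
apply/funext => xi; rewrite mulmxBl mulmxBr.
by apply/matrixP => i j; rewrite !mxE; ring.
Qed.

(** A choice of e1 that handles both terms of [Lnrm_mulmx_dist]: W bounds the moving factor z
    uniformly, N is the norm of the fixed factor x1. *)
Let prod_small (W N e : R) : 0 <= W -> 0 <= N -> 0 < e ->
  exists2 e1 : R, 0 < e1 & forall y1 y2 y3 : R,
    0 <= y1 -> 0 <= y3 -> y1 <= W -> y2 < e1 -> y3 < e1 ->
    0 <= y2 -> d%:R * y1 * y2 + d%:R * y3 * N < e.
Proof.
move=> W0 N0 e0; have d0 : 0 <= d%:R :> R by [].
set D := d%:R in d0 *.
have Q0 : 0 < D * W + D * N + 1 by rewrite ltr_wpDl// addr_ge0// mulr_ge0.
exists (e / (D * W + D * N + 1)); first by rewrite divr_gt0.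
move=> y1 y2 y3 y10 y30 y1W y2e y3e y20.
set e1 := e / _ in y2e y3e.
have e10 : 0 < e1 by rewrite divr_gt0.
apply: (@le_lt_trans _ _ (D * W * e1 + D * e1 * N)).
  apply: lerD.
    by apply: ler_pM; rewrite ?mulr_ge0// ?ler_wpM2l// ltW.
  by rewrite ler_wpM2r// ler_wpM2l// ltW.
rewrite [ltLHS](_ : _ = (D * W + D * N) * e1); last by ring.
by rewrite /e1 mulrA ltr_pdivrMr// mulrC ltr_pM2l// ltrDl.
Qed.

Lemma cont2_riemann : cont2 phi gam 0 T A.
Proof.
have /(@cont2P _ _ _ phi_meas)[_ cx1] := Hx1.1.
apply/(@cont2P _ _ _ phi_meas); split; first exact: inL_riemann.
move=> t s s0 st tT e e0; have sT := le_trans st tT.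
have [e1 e10 He] := prod_small Z0 (Lnrm_ge0 phi gam (x1 t s)) e0.
have [d1 d10 H1] := cx1 t s s0 st tT e1 e10.
have [d2 d20 H2] := holder_cont s0 sT e10.
exists (Num.min d1 d2); first by rewrite lt_min d10.
move=> t' s' s'0 st' t'T; rewrite !lt_min => /andP[t1 _] /andP[s1 s2].
have s'T := le_trans st' t'T.
apply: (le_lt_trans (Lnrm_mulmx_dist _ _ (Lx1 s0 st tT) (Lx1 s'0 st' t'T))).
by apply: He; rewrite ?Lnrm_ge0 ?zZ//; [exact: H1|exact: H2].
Qed.

Lemma cont3_hterm : cont3 phi gam 0 T h.
Proof.
have /(@cont2P _ _ _ phi_meas)[_ cx1] := Hx1.1.
split; first exact: inL_hterm.
move=> t u s s0 su ut tT e e0.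
have u0 := le_trans s0 su; have uT := le_trans ut tT; have sT := le_trans su uT.
have ZZ0 : 0 <= Z + Z by rewrite addr_ge0.
have [e1 e10 He] := prod_small ZZ0 (Lnrm_ge0 phi gam (x1 t u)) e0.
have e20 : 0 < e1 / 2 by rewrite divr_gt0.
have [d1 d10 H1] := cx1 t u u0 ut tT e1 e10.
have [d2 d20 H2] := holder_cont u0 uT e20.
have [d3 d30 H3] := holder_cont s0 sT e20.
exists (Num.min d1 (Num.min d2 d3)); first by rewrite !lt_min d10 d20.
move=> t' u' s' s'0 su' ut' t'T; rewrite !lt_min.
move=> /and3P[t1 _ _] /and3P[u1 u2 _] /and3P[_ _ s3].
have u'0 := le_trans s'0 su'; have u'T := le_trans ut' t'T; have s'T := le_trans su' u'T.
rewrite NLE; last by apply: inLB => //; exact: inL_hterm.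
rewrite lte_fin.
apply: (le_lt_trans (Lnrm_mulmx_dist _ _ (Lx1 u0 ut tT) (Lx1 u'0 ut' t'T))).
apply: He => //; rewrite ?Lnrm_ge0//.
- by rewrite (le_trans (ler_normB _ _))// lerD// zZ.
- exact: H1.
- rewrite (_ : _ - _ = (z u' - z u) - (z s' - z s)); last first.
    by apply/matrixP => i j; rewrite !mxE; ring.
  rewrite (le_lt_trans (ler_normB _ _))//.
  by have := H2 u' u'0 u'T u2; have := H3 s' s'0 s'T s3; lra.
Qed.

Lemma inC3_hterm : inC3 phi gam (2 * gam) 0 T h.
Proof.
split; first exact: cont3_hterm.
apply: (@le_lt_trans _ _ (d%:R * K * Hz)%:E); last exact: ltry.
(* The decomposition has the single piece h with rho = gam, the midpoint of (0, 2 gam). *)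
apply: (@le_trans _ _ (\sum_(p <- [:: (h, gam)]) N3piece phi gam (2 * gam) 0 T p)%E).
  apply: ereal_inf_lbound; exists [:: (h, gam)]; split => //.
    by rewrite /= andbT gam0/=; have := gam0; lra.
  move=> t u s s0 su ut tT.
  rewrite -[RHS](NL_cst0 phi gam 1 m); apply: NL_ext => xi _.
  by rewrite /fsub big_seq1 subrr.
rewrite big_seq1; apply: ge_ereal_sup => _ [t [u [s [s0 su ut tT ->]]]] /=.
have uT := le_trans (ltW ut) tT.
rewrite NLE; last by apply: inL_hterm => //; exact: ltW.
have -> : 2 * gam - gam = gam by ring.
rewrite -EFinM lee_fin -invfM ler_pdivrMr; last first.
  by rewrite mulr_gt0// powR_gt0 ?subr_gt0.
by apply: hterm_bound2; rewrite ?(ltW su) ?(ltW ut)// zus// ltW.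
Qed.

Lemma sew_dom_hterm : sew_dom phi gam (2 * gam) 0 T h.
Proof.
split; first exact: inC3_hterm.
(* The primitive - A has only the regularity gam, but the domain asks a primitive for continuity
   alone. *)
exists (fun t s xi => - A t s xi); split; first exact: (cont2N cont2_riemann).
move=> t u s s0 su ut tT.
have [L N] := dlt2_riemann s0 su ut tT.
rewrite -[RHS](congr1 EFin N) -NLE//; apply: NL_ext => xi _.
rewrite -normrN; congr (`|_|); rewrite /fsub /dlt2.
by apply/matrixP => i j; rewrite !mxE; ring.
Qed.

(** Half of the excess of 2 gam over 1: 1 + 2 e = 2 gam and 1 + e = gam + 1/2. *)
Let e := gam - 1 / 2.

(** The bound inherited from the limit has exponent 1 + e only; [sewing_bound] raises it to 2 gam
    because [dlt2 M] is h up to a null function. Continuity is obtained for J and A separately. *)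
Lemma sew_spec_exists : exists M, sew_spec phi gam (2 * gam) 0 T h M.
Proof.
have e0 : 0 < e by rewrite /e; have := gam1; lra.
have muE : 1 + 2 * e = 2 * gam by rewrite /e; field.
have C0 : 0 <= d%:R * K * Hz by rewrite !mulr_ge0.
have dA (t u s : R) : 0 <= s -> s <= u -> u <= t -> t <= T ->
    Lnrm (dlt2 A t u s) <= d%:R * K * Hz * (t - s) `^ (1 + 2 * e).
  by rewrite muE; exact: Lnrm_dlt2_riemann.
have [J [LJ dJ [K' K'0 JA]]] := sewing_limit phi_meas T0 C0 e0 inL_riemann dA.
pose M t s xi := J t s xi - A t s xi.
have LM (t s : R) : 0 <= s -> s <= t -> t <= T -> inL (M t s).
  by move=> *; apply: inLB => //; [exact: LJ|exact: inL_riemann].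
have LdJ (t u s : R) : 0 <= s -> s <= u -> u <= t -> t <= T -> inL (dlt2 J t u s).
  by move=> s0 su ut tT; apply: inL_dlt2 => //; apply: LJ => //;
    [exact: le_trans ut|exact: le_trans su|exact: le_trans tT].
have dM (t u s : R) : 0 <= s -> s <= u -> u <= t -> t <= T ->
    Lnrm (fun xi => dlt2 M t u s xi - h t u s xi) = 0.
  move=> s0 su ut tT; have [L N] := dlt2_riemann s0 su ut tT.
  apply/eqP; rewrite eq_le Lnrm_ge0 andbT.
  rewrite (_ : (fun xi => _) = (fun xi => dlt2 J t u s xi - (dlt2 A t u s xi + h t u s xi))).
    by rewrite (le_trans (LnrmB phi_meas (LdJ _ _ _ s0 su ut tT) L))// N dJ// addr0.
  apply/funext => xi; rewrite /dlt2 /M.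
  by apply/matrixP => i j; rewrite !mxE; ring.
have LdM (t u s : R) : 0 <= s -> s <= u -> u <= t -> t <= T -> inL (dlt2 M t u s).
  by move=> s0 su ut tT; apply: inL_dlt2 => //; apply: LM => //;
    [exact: le_trans ut|exact: le_trans su|exact: le_trans tT].
have Mmu : forall t s : R, 0 <= s -> s < t -> t <= T -> Lnrm (M t s) <=
    d%:R * K * Hz / (1 - 2^-1 `^ (2 * gam - 1)) * (t - s) `^ (2 * gam).
  apply: (sewing_bound (nu := 1 + e) (K := K') phi_meas).
  - by have := gam1; lra.
  - by rewrite ltrDl.
  - by move=> t s s0 st tT; apply: LM => //; exact: ltW.
  - by move=> t s s0 st tT; apply: JA => //; exact: ltW.
  - move=> t u s s0 /ltW su /ltW ut tT.
    have Lh := inL_hterm s0 su ut tT.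
    have := LnrmD phi_meas (inLB phi_meas (LdM _ _ _ s0 su ut tT) Lh) Lh.
    rewrite dM// add0r (_ : (fun xi => _ + _) = dlt2 M t u s); last first.
      by apply/funext => xi; rewrite subrK.
    move=> H; apply: (le_trans H); apply: hterm_bound => //.
    by apply: zus => //; exact: le_trans tT.
(* Continuity of J requires a single power of t - s: the spare factor (t - s)^(1/2) in the bound on
   M is absorbed into T^(1/2), leaving gam. *)
have JK (t s : R) : 0 <= s -> s <= t -> t <= T ->
    Lnrm (J t s) <= (d%:R * Z * K + K' * T `^ (1 / 2)) * (t - s) `^ gam.
  move=> s0 st tT; have sT := le_trans st tT.
  rewrite (_ : J t s = (fun xi => A t s xi + M t s xi)); last first.
    by apply/funext => xi; rewrite /M addrC subrK.
  apply: (le_trans (LnrmD phi_meas (inL_riemann s0 st tT) (LM _ _ s0 st tT))).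
  rewrite mulrDl; apply: lerD.
    apply: (le_trans (inL_mulmx phi_meas (z s) (Lx1 s0 st tT)).2).
    rewrite -!mulrA ler_wpM2l// ler_pM// ?Lnrm_ge0 ?zZ//; exact: x1K.
  apply: (le_trans (JA _ _ s0 st tT)); rewrite -mulrA ler_wpM2l//.
  rewrite (_ : 1 + e = 1 / 2 + gam); last by rewrite /e; field.
  rewrite powRD; last by apply/implyP; have := gam0; lra.
  rewrite ler_wpM2r ?powR_ge0//; apply: ge0_ler_powR; rewrite ?nnegrE//; lra.
have JK0 : 0 <= d%:R * Z * K + K' * T `^ (1 / 2).
  by rewrite addr_ge0// ?mulr_ge0// powR_ge0.
exists M; split; last first.
  move=> t u s s0 su ut tT; rewrite NLE; first by congr EFin; exact: dM.
  by apply: inLB => //; [exact: LdM|exact: inL_hterm].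
split.
  apply: (cont2D phi_meas); first exact: (cont2_additive phi_meas gam0 JK0 LJ dJ JK).
  exact: (cont2N cont2_riemann).
apply: le_lt_trans (N2_le _ Mmu) (ltry _).
by move=> t s s0 st tT; apply: LM => //; exact: ltW.
Qed.

Let M := sew phi gam (2 * gam) 0 T h.

Lemma sewP : sew_spec phi gam (2 * gam) 0 T h M.
Proof. by apply: ClassicalEpsilon.epsilon_spec; exact: sew_spec_exists. Qed.

Let LM (t s : R) : 0 <= s -> s <= t -> t <= T -> inL (M t s).
Proof. exact: sewP.1.1.1. Qed.

Let dM (t u s : R) : 0 <= s -> s <= u -> u <= t -> t <= T ->
  inL (fun xi => dlt2 M t u s xi - h t u s xi) /\
  Lnrm (fun xi => dlt2 M t u s xi - h t u s xi) = 0.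
Proof.
move=> s0 su ut tT; split; last by apply/NL_eq0/sewP.2.
apply: inLB => //; last exact: inL_hterm.
by apply: inL_dlt2 => //; apply: LM => //;
    [exact: le_trans ut|exact: le_trans su|exact: le_trans tT].
Qed.

(** The constant of [sewing_bound] for exponent 2 gam, with the Hölder constant of z factored out,
    so that the value is independent of z. *)
Definition young_const := d%:R * K / (1 - 2^-1 `^ (2 * gam - 1)).

Lemma young_const_ge0 : 0 <= young_const.
Proof.
rewrite mulr_ge0// ?mulr_ge0// invr_ge0 subr_ge0 ltW// powR_half_lt1//.
by have := gam1; lra.
Qed.

Lemma sew_bound (l1 l2 H : R) : 0 <= l1 -> l2 <= T -> 0 <= H ->
  (forall s t : R, l1 <= s -> s <= l2 -> l1 <= t -> t <= l2 ->
      `|z t - z s| <= H * `|t - s| `^ gam) ->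
  forall t s : R, l1 <= s -> s < t -> t <= l2 ->
    Lnrm (M t s) <= young_const * H * (t - s) `^ (2 * gam).
Proof.
move=> l10 l2T H0 zHl.
have [K' _ MK'] := N2_bound sewP.1.
rewrite /young_const (mulrAC _ _ H).
apply: (sewing_bound (nu := 2 * gam) (K := K') phi_meas).
- by have := gam1; lra.
- by have := gam1; lra.
- by move=> t s ls st tl; apply: LM; [exact: le_trans ls|exact: ltW|exact: le_trans l2T].
- by move=> t s ls st tl; apply: MK'; [exact: le_trans ls| |exact: le_trans l2T].
- move=> t u s ls su ut tl.
  have s0 := le_trans l10 ls; have tT := le_trans tl l2T.
  have [L N] := dM s0 (ltW su) (ltW ut) tT.
  have Lh := inL_hterm s0 (ltW su) (ltW ut) tT.
  have := LnrmD phi_meas L Lh; rewrite N add0r (_ : (fun xi => _ + _) = dlt2 M t u s); last first.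
    by apply/funext => xi; rewrite subrK.
  move=> N'; apply: (le_trans N'); apply: hterm_bound => //; [exact: ltW..|].
  rewrite -[X in _ <= _ * X `^ _]ger0_norm ?subr_ge0; last exact: ltW.
  by apply: zHl; lra.
Qed.

Let J := Jint phi gam T x1 z.

Lemma inL_Jint (t s : R) : 0 <= s -> s <= t -> t <= T -> inL (J t s).
Proof. by move=> *; apply: inLD => //; [exact: inL_riemann|exact: LM]. Qed.

Lemma Jint_additive (t u s : R) : 0 <= s -> s <= u -> u <= t -> t <= T ->
  inL (dlt2 J t u s) /\ Lnrm (dlt2 J t u s) = 0.
Proof.
move=> s0 su ut tT; have [L N] := dlt2_riemann s0 su ut tT.
have [L' N'] := dM s0 su ut tT.
rewrite (_ : dlt2 J t u s = (fun xi => (dlt2 A t u s xi + h t u s xi)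
  + (dlt2 M t u s xi - h t u s xi))); last first.
  apply/funext => xi; rewrite /J /Jint /dlt2 -/M.
  by apply/matrixP => i j; rewrite !mxE; ring.
split; first exact: inLD.
apply/eqP; rewrite eq_le Lnrm_ge0 andbT.
by rewrite (le_trans (LnrmD phi_meas L L'))// N N' addr0.
Qed.

Lemma Jint_bound (l1 l2 H X : R) : 0 <= l1 -> l2 <= T -> 0 <= H ->
  (forall s t : R, l1 <= s -> s <= l2 -> l1 <= t -> t <= l2 ->
      `|z t - z s| <= H * `|t - s| `^ gam) ->
  (forall s : R, l1 <= s -> s <= l2 -> `|z s| <= X) ->
  forall t s : R, l1 <= s -> s < t -> t <= l2 ->
    Lnrm (J t s) <= (d%:R * K + young_const + 1) * (X + (l2 - l1) `^ gam * H) * (t - s) `^ gam.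
Proof.
move=> l10 l2T H0 zHl zX t s ls st tl.
have s0 := le_trans l10 ls; have tT := le_trans tl l2T; have st' := ltW st.
have X0 : 0 <= X by apply: le_trans (zX s ls _) => //; lra.
apply: (le_trans (LnrmD phi_meas (inL_riemann s0 st' tT) (LM s0 st' tT))).
have N1 : Lnrm (A t s) <= d%:R * K * X * (t - s) `^ gam.
  apply: (le_trans (inL_mulmx phi_meas (z s) (Lx1 s0 st' tT)).2).
  rewrite [leRHS](_ : _ = d%:R * (X * (K * (t - s) `^ gam))); last by ring.
  rewrite -mulrA ler_wpM2l// ler_pM ?Lnrm_ge0//; last exact: x1K.
  by apply: zX => //; lra.
have N2 := sew_bound l10 l2T H0 zHl ls st tl.
have yc := young_const_ge0.
(* One of the two factors (t - s)^gam is given up to (l2 - l1)^gam; this is the power of epsilon in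
   (2). *)
have pE : (t - s) `^ (2 * gam) <= (l2 - l1) `^ gam * (t - s) `^ gam.
  have -> : 2 * gam = gam + gam by ring.
  rewrite powRD; last by apply/implyP; have := gam0; lra.
  rewrite ler_wpM2r ?powR_ge0//; apply: ge0_ler_powR; rewrite ?nnegrE ?(ltW gam0)//; lra.
have N3 : Lnrm (M t s) <= young_const * H * ((l2 - l1) `^ gam * (t - s) `^ gam).
  by rewrite (le_trans N2)// ler_wpM2l// mulr_ge0.
apply: (le_trans (lerD N1 N3)); rewrite -subr_ge0.
set P := (l2 - l1) `^ gam; set Q := (t - s) `^ gam; set c := young_const in yc *.
rewrite [leRHS](_ : _ = (c + 1) * X * Q + (d%:R * K + 1) * (P * H * Q)); last by ring.
by rewrite addr_ge0// !mulr_ge0// ?addr_ge0// ?mulr_ge0// powR_ge0.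
Qed.

Lemma Jint_inC2 : inC2 phi gam gam 0 T J.
Proof.
split; first by apply: (cont2D phi_meas); [exact: cont2_riemann|exact: sewP.1.1].
have B := Jint_bound (lexx 0) (lexx T) Hz0 zH zZ.
apply: le_lt_trans (N2_le _ B) (ltry _).
by move=> t s s0 st tT; apply: inL_Jint => //; exact: ltW.
Qed.

(** Induction on the last cell: the error accumulated so far is carried over it by a contraction,
    and the cell adds J - A = M. *)
Lemma Jint_Jsum (n : nat) (p : nat -> R) : 0 <= p 0%N -> p n.+1 <= T ->
  (forall i, (i <= n)%N -> p i < p i.+1) ->
  Lnrm (fun xi => J (p n.+1) (p 0%N) xi - Jsum x1 z (p n.+1) n p xi) <=
  \sum_(i < n.+1) Lnrm (M (p i.+1) (p i)) /\ inL (Jsum x1 z (p n.+1) n p).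
Proof.
move=> p0.
elim: n => [|n IH] pT pm.
  rewrite (_ : Jsum _ _ _ _ _ = A (p 1%N) (p 0%N)); last first.
    by apply/funext => xi; rewrite /Jsum big_ord1 subrr ecv0r scale1r.
  split; last by apply: inL_riemann => //; apply/ltW/pm.
  rewrite big_ord1 (_ : (fun xi => _) = M (p 1%N) (p 0%N))//.
  by apply/funext => xi; rewrite /J /Jint addrC addKr.
have pm' i : (i <= n)%N -> p i < p i.+1 by move=> ni; exact/pm/leqW.
have p12 := pm n.+1 (leqnn _).
have p1T := le_trans (ltW p12) pT.
have [IHn LJs] := IH p1T pm'.
have p01 : p 0%N <= p n.+1.
  have le0 k : (k <= n.+1)%N -> p 0%N <= p k.
    elim: k => // k IHk kn; apply: le_trans (IHk (ltnW kn)) (ltW (pm' _ _)).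
    by rewrite -ltnS.
  exact: le0.
have p02 := le_trans p01 (ltW p12); have p10 := le_trans p0 p01.
have r0 : 0 <= p n.+2 - p n.+1 by rewrite subr_ge0 ltW.
have LA' := inL_riemann p10 (ltW p12) pT.
have [L1 N1] := inL_ecv phi_meas r0 LJs.
have JsE : Jsum x1 z (p n.+2) n.+1 p = (fun xi => ecv xi (p n.+2 - p n.+1) *:
    Jsum x1 z (p n.+1) n p xi + A (p n.+2) (p n.+1) xi).
  apply/funext => xi; rewrite /Jsum big_ord_recr/= subrr ecv0r scale1r.
  congr (_ + _); rewrite scaler_sumr; apply: eq_bigr => i _.
  by rewrite scalerA -ecvD; congr (ecv _ _ *: _); ring.
rewrite JsE; split; last exact: inLD.
have [Ld Nd] := Jint_additive p0 p01 (ltW p12) pT.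
have LD := inLB phi_meas (inL_Jint p0 p01 p1T) LJs.
have [L2 N2] := inL_ecv phi_meas r0 LD.
have LMn := LM p10 (ltW p12) pT.
rewrite big_ord_recr/=.
rewrite (_ : (fun xi => _) = (fun xi => dlt2 J (p n.+2) (p n.+1) (p 0%N) xi +
   (ecv xi (p n.+2 - p n.+1) *: (J (p n.+1) (p 0%N) xi - Jsum x1 z (p n.+1) n p xi)
    + M (p n.+2) (p n.+1) xi))); last first.
  apply/funext => xi; rewrite /dlt2 {3}/J /Jint -/A -/M.
  by apply/matrixP => i j; rewrite !mxE; ring.
apply: (le_trans (LnrmD phi_meas Ld (inLD phi_meas L2 LMn))).
rewrite Nd add0r; apply: (le_trans (LnrmD phi_meas L2 LMn)).
by rewrite lerD2r (le_trans N2).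
Qed.

Lemma Jsum_cvg (s t : R) : 0 <= s -> s < t -> t <= T ->
  forall e : R, 0 < e -> exists2 del : R, 0 < del &
    forall (n : nat) (p : nat -> R),
      p 0%N = s -> p n.+1 = t ->
      (forall i, (i <= n)%N -> p i < p i.+1) ->
      (forall i, (i <= n)%N -> p i.+1 - p i < del) ->
      inL (Jsum x1 z t n p) /\
      Lnrm (fun xi => J t s xi - Jsum x1 z t n p xi) < e.
Proof.
move=> s0 st tT eps eps0.
have e0 : 0 < e by rewrite /e; have := gam1; lra.
have muE : 1 + 2 * e = 2 * gam by rewrite /e; field.
have c0 : 0 <= young_const * Hz * (t - s) `^ (1 + e).
  exact: mulr_ge0 (mulr_ge0 young_const_ge0 Hz0) (powR_ge0 _ _).
(* By [sum_powR_cells], the total error is at most del^e times the constant of [c0], whatever the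
   number of cells. *)
have [del del0 Hdel] := powR_small e0 c0 eps0.
exists del => // n p p0 pn pm pd.
have p00 : 0 <= p 0%N by rewrite p0.
have pnT : p n.+1 <= T by rewrite pn.
have [N L] := Jint_Jsum p00 pnT pm.
rewrite p0 pn in N L; split => //.
apply: (le_lt_trans N); apply: le_lt_trans (Hdel del (ltW del0) (lexx _)).
apply: (@le_trans _ _ (\sum_(i < n.+1) young_const * Hz * (p i.+1 - p i) `^ (2 * gam))).
  have ple k l : (k <= l)%N -> (l <= n.+1)%N -> p k <= p l.
    move=> /subnK <-; elim: (l - k)%N => // j IH; rewrite addSn => jn.
    by apply: le_trans (IH (ltnW jn)) (ltW (pm _ _)); rewrite -ltnS.
  apply: ler_sum => i _; apply: (sew_bound (lexx 0) (lexx T) Hz0 zH).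
  - by rewrite (le_trans p00)// ple// ltnW.
  - by apply: pm; rewrite -ltnS.
  - by rewrite (le_trans (ple _ n.+1 _ _)).
rewrite -mulr_sumr -muE -[leRHS]mulrA.
rewrite ler_wpM2l ?(mulr_ge0 young_const_ge0 Hz0)//.
have := sum_powR_cells (N := n.+1) (r := p) (del := del) e0 
  (fun k kn => ltW (pm k kn)) (fun k kn => ltW (pd k kn)).
rewrite p0 pn [X in _ -> _ <= X]mulrC; apply.
Qed.
End Young.

(** * Entrywise integrals of continuous matrix paths *)

Section Matrix_integral.
Variable R : realType.
Local Notation mu := (@lebesgue_measure R).

Lemma continuous_itv_integrable (f : R -> R) (s t : R) : continuous f ->
  mu.-integrable `[s, t] (EFin \o f).
Proof.
move=> cf; apply: continuous_compact_integrable; first exact: segment_compact.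
exact: continuous_subspaceT.
Qed.

Lemma Rintegral_itv_add (f : R -> R) (s u t : R) : continuous f -> s <= u -> u <= t ->
  \int[mu]_(v in `[s, t]) f v = \int[mu]_(v in `[s, u]) f v + \int[mu]_(v in `[u, t]) f v.
Proof.
move=> cf su ut; have If := continuous_itv_integrable s t cf.
have := @Rintegral_itvB R f (BLeft s) (BRight t) u If.
rewrite !bnd_simp => /(_ su ut).
rewrite Rintegral_itv_obnd_cbnd; last first.
  apply: integrableS (continuous_itv_integrable u t cf) => //.
  by apply: subset_itvr; rewrite bnd_simp.
by move=> <-; rewrite addrC subrK.
Qed.

Lemma Rintegral_itv_le (f : R -> R) (s t c : R) : continuous f -> s <= t ->
  (forall v, s <= v -> v <= t -> `|f v| <= c) ->
  `|\int[mu]_(v in `[s, t]) f v| <= c * (t - s).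
Proof.
move=> cf st fc; have If := continuous_itv_integrable s t cf.
apply: (le_trans (le_normr_Rintegral _ If)) => //.
have -> : c * (t - s) = \int[mu]_(v in `[s, t]) c.
  rewrite Rintegral_cst//=  lebesgue_measure_itv/= lte_fin.
  move: st; rewrite le_eqVlt => /orP[/eqP ->|->//].
  by rewrite ltxx subrr.
apply: le_Rintegral => //.
- apply: (continuous_itv_integrable s t (f := fun v => `|f v|)) => v.
  by apply: continuous_comp; [exact: cf|exact: norm_continuous].
- exact: continuous_itv_integrable (@cst_continuous _ _ c).
- by move=> v /=; rewrite in_itv/= => /andP[]; exact: fc.
Qed.


Lemma Rintegral_itv_sum (I : finType) (F : I -> R -> R) (s t : R) :
  (forall i, continuous (F i)) ->
  \int[mu]_(v in `[s, t]) (\sum_i F i v) = \sum_i \int[mu]_(v in `[s, t]) F i v.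
Proof.
move=> cF; elim: (index_enum I) => [|i r IH].
  rewrite big_nil (eq_Rintegral _ (g := cst 0)) ?Rintegral_cst ?mul0r// => v _.
  by rewrite big_nil.
rewrite big_cons -IH -RintegralD//; first by apply: eq_Rintegral => v _; rewrite big_cons.
  exact: continuous_itv_integrable.
apply: continuous_itv_integrable => v.
by apply: cvg_big => [|k _]; [exact: add_continuous|exact: cF].
Qed.

Definition mxcont a b (F : R -> 'M[R]_(a, b)) :=
  forall i j, continuous (fun v => F v i j).

Lemma mxcont_continuous a b (F : R -> 'M[R]_(a, b)) : continuous F -> mxcont F.
Proof.
move=> cF i j v; apply: (@continuous_comp _ _ _ F (fun M : 'M[R]_(a, b) => M i j)).
  exact: cF.
exact: coord_continuous.
Qed.

Lemma mxcontB a b (F G : R -> 'M[R]_(a, b)) : mxcont F -> mxcont G ->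
  mxcont (fun v => F v - G v).
Proof.
move=> cF cG i j.
rewrite (_ : (fun v => _) = (fun v => F v i j - G v i j)); last first.
  by apply/funext => v; rewrite !mxE.
by move=> v; apply: cvgB; [exact: cF|exact: cG].
Qed.

Lemma mxcontZ a b (k : R -> R) (F : R -> 'M[R]_(a, b)) : continuous k -> mxcont F ->
  mxcont (fun v => k v *: F v).
Proof.
move=> ck cF i j.
rewrite (_ : (fun v => _) = (fun v => k v * F v i j)); last first.
  by apply/funext => v; rewrite !mxE.
by move=> v; apply: cvgM; [exact: ck|exact: cF].
Qed.

Lemma mxcontM a b c (F : R -> 'M[R]_(a, b)) (G : R -> 'M[R]_(b, c)) :
  mxcont F -> mxcont G -> mxcont (fun v => F v *m G v).
Proof.
move=> cF cG i j.
rewrite (_ : (fun v => _) = (fun v => \sum_k F v i k * G v k j)); last first.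
  by apply/funext => v; rewrite !mxE.
move=> v; apply: cvg_big => [|k _]; first exact: add_continuous.
by apply: cvgM; [exact: cF|exact: cG].
Qed.

Lemma continuous_ecv (xi t : R) : continuous (fun v => ecv xi (t - v)).
Proof.
move=> v; apply: (@continuous_comp _ _ _ (fun v => - (xi * (t - v))) expR).
  apply: cvgN; apply: cvgM; first exact: cvg_cst.
  by apply: cvgB; [exact: cvg_cst|exact: cvg_id].
exact: continuous_expR.
Qed.

Variables a b : nat.
Implicit Types F G : R -> 'M[R]_(a, b).

Lemma eq_Mint F G (s t : R) : (forall v, F v = G v) -> Mint s t F = Mint s t G.
Proof. by move=> FG; congr Mint; exact/funext. Qed.

Lemma Mint_add F (s u t : R) : mxcont F -> s <= u -> u <= t ->
  Mint s t F = Mint s u F + Mint u t F.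
Proof.
by move=> cF su ut; apply/matrixP => i j; rewrite !mxE; exact: Rintegral_itv_add.
Qed.

Lemma Mint_sub F G (s t : R) : mxcont F -> mxcont G ->
  Mint s t (fun v => F v - G v) = Mint s t F - Mint s t G.
Proof.
move=> cF cG; apply/matrixP => i j; rewrite !mxE -RintegralB//.
- by apply: eq_Rintegral => v _; rewrite !mxE.
- exact: continuous_itv_integrable.
- exact: continuous_itv_integrable.
Qed.

Lemma Mint_scale F (k s t : R) : mxcont F ->
  Mint s t (fun v => k *: F v) = k *: Mint s t F.
Proof.
move=> cF; apply/matrixP => i j; rewrite !mxE -RintegralZl//.
- by apply: eq_Rintegral => v _; rewrite !mxE.
- exact: continuous_itv_integrable.
Qed.

Lemma Mint_mulmx c F (X : 'M[R]_(b, c)) (s t : R) : mxcont F ->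
  Mint s t (fun v => F v *m X) = Mint s t F *m X.
Proof.
move=> cF; apply/matrixP => i j; rewrite !mxE.
transitivity (\int[mu]_(v in `[s, t]) (\sum_k F v i k * X k j)).
  by apply: eq_Rintegral => v _; rewrite !mxE.
rewrite Rintegral_itv_sum => [|k v]; last first.
  by apply: cvgM; [exact: cF|exact: cvg_cst].
apply: eq_bigr => k _; rewrite !mxE -RintegralZr//.
exact: continuous_itv_integrable.
Qed.

Lemma Mint_le F (s t c : R) : mxcont F -> s <= t -> 0 <= c ->
  (forall v, s <= v -> v <= t -> `|F v| <= c) -> `|Mint s t F| <= c * (t - s).
Proof.
move=> cF st c0 Fc; apply: mxnorm_le => [|i j]; first by rewrite mulr_ge0// subr_ge0.
rewrite mxE; apply: Rintegral_itv_le => // v sv vt.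
exact: le_trans (mxnorm_entry _ _ _) (Fc v sv vt).
Qed.

Lemma Mint_diag F (s : R) : Mint s s F = 0.
Proof. by apply/matrixP => i j; rewrite !mxE set_itv1 Rintegral_set1. Qed.

End Matrix_integral.

(** * Agreement with the classical integral for smooth paths *)

Section Smooth_case.
Variables (R : realType) (phi : R -> R).
Hypothesis phi_meas : measurable_fun (`]0%R, +oo[ : set R) phi.
Variables (d m : nat) (T gam : R).
Hypothesis gam0 : 0 < gam.
Variables (y : R -> 'M[R]_(1, d)) (z : R -> 'M[R]_(d, m)).
Hypotheses (cy : mxcont y) (cz : mxcont z).
Variables (Y Hz : R).
Hypotheses (Y0 : 0 <= Y) (Hz0 : 0 <= Hz).
Hypothesis yY : forall v : R, 0 <= v -> v <= T -> `|y v| <= Y.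
Hypothesis zH : forall s t : R, 0 <= s -> s <= T -> 0 <= t -> t <= T ->
  `|z t - z s| <= Hz * `|t - s| `^ gam.
Variable x1 : R -> R -> R -> 'M[R]_(1, d).
Hypothesis x1E : forall t s xi : R, 0 <= s -> s <= t -> t <= T -> 0 <= xi ->
  x1 t s xi = Mint s t (fun v => ecv xi (t - v) *: y v).

Let Phi t s xi := Mint s t (fun v => ecv xi (t - v) *: (y v *m z v)).
Let c := d%:R * Hz * Y.

Let c0 : 0 <= c. Proof. by rewrite !mulr_ge0. Qed.

Let cPhi (t xi : R) : mxcont (fun v => ecv xi (t - v) *: (y v *m z v)).
Proof. by apply: mxcontZ; [exact: continuous_ecv|exact: mxcontM]. Qed.

Let Phi_add (t u s xi : R) : s <= u -> u <= t ->
  Phi t s xi = Phi t u xi + ecv xi (t - u) *: Phi u s xi.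
Proof.
move=> su ut; rewrite /Phi (Mint_add (@cPhi t xi) su ut) addrC; congr (_ + _).
rewrite -Mint_scale//; apply: eq_Mint => v.
by rewrite scalerA -ecvD; congr (ecv _ _ *: _); ring.
Qed.

(** The Riemann term is the same integral with z frozen at the left end, so the error is the
    oscillation of z on the cell times its length, of order 1 + gam, uniformly in xi >= 0. *)
Let Phi_cell (t s xi : R) : 0 <= s -> s <= t -> t <= T -> 0 <= xi ->
  `|Phi t s xi - x1 t s xi *m z s| <= c * (t - s) `^ gam * (t - s).
Proof.
move=> s0 st tT xi0; have sT := le_trans st tT.
have cey : mxcont (fun v => ecv xi (t - v) *: y v).
  by apply: mxcontZ => //; exact: continuous_ecv.
have ceyz : mxcont (fun v => (ecv xi (t - v) *: y v) *m z s).
  by apply: mxcontM => // i j; exact: cst_continuous.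
rewrite x1E// -Mint_mulmx// -Mint_sub//.
apply: Mint_le => //; first exact: mxcontB.
  by rewrite mulr_ge0// powR_ge0.
move=> v sv vt; have v0 := le_trans s0 sv; have vT := le_trans vt tT.
rewrite -scalemxAl -scalerBr -mulmxBr normrZ ger0_norm ?ecv_ge0//.
apply: (@le_trans _ _ (`|y v *m (z v - z s)|)).
  by rewrite ler_piMl// ecv_le1// subr_ge0.
apply: (le_trans (mxnorm_mul _ _)).
rewrite /c [leRHS](_ : _ = d%:R * (Hz * (t - s) `^ gam) * Y); last by ring.
apply: ler_pM; rewrite ?mulr_ge0 ?yY// ler_wpM2l//.
apply: (le_trans (zH s0 sT v0 vT)); rewrite ler_wpM2l//.
rewrite ger0_norm ?subr_ge0//.
by apply: ge0_ler_powR; rewrite ?nnegrE ?(ltW gam0) ?subr_ge0// lerB.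
Qed.

Let Phi_Jsum (n : nat) (p : nat -> R) (xi : R) : 0 <= xi -> 0 <= p 0%N -> p n.+1 <= T ->
  (forall i, p i <= p i.+1) ->
  `|Phi (p n.+1) (p 0%N) xi - Jsum x1 z (p n.+1) n p xi| <=
  \sum_(i < n.+1) c * (p i.+1 - p i) `^ gam * (p i.+1 - p i).
Proof.
move=> xi0 p0 + pm; have p0k k : p 0%N <= p k.
  by elim: k => // k IH; exact: le_trans IH (pm k).
elim: n => [|n IH] pT.
  by rewrite /Jsum !big_ord1 subrr ecv0r scale1r Phi_cell.
have p1T := le_trans (pm n.+1) pT.
rewrite big_ord_recr/= (Phi_add _ (p0k n.+1) (pm n.+1)).
have -> : Jsum x1 z (p n.+2) n.+1 p xi = ecv xi (p n.+2 - p n.+1) *: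
    Jsum x1 z (p n.+1) n p xi + x1 (p n.+2) (p n.+1) xi *m z (p n.+1).
  rewrite /Jsum big_ord_recr/= subrr ecv0r scale1r.
  congr (_ + _); rewrite scaler_sumr; apply: eq_bigr => i _.
  by rewrite scalerA -ecvD; congr (ecv _ _ *: _); ring.
rewrite [X in `|X|](_ : _ = ecv xi (p n.+2 - p n.+1) *:
    (Phi (p n.+1) (p 0%N) xi - Jsum x1 z (p n.+1) n p xi) +
    (Phi (p n.+2) (p n.+1) xi - x1 (p n.+2) (p n.+1) xi *m z (p n.+1))); last first.
  by rewrite scalerBr opprD (addrC (Phi (p n.+2) _ _)) addrACA.
apply: (le_trans (ler_normD _ _)); apply: lerD; last first.
  by apply: Phi_cell => //; exact: le_trans (p0k _).
rewrite normrZ ger0_norm ?ecv_ge0//; apply: le_trans (IH p1T).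
by rewrite ler_piMl// ecv_le1// subr_ge0.
Qed.

Definition unif_part (s t : R) (n k : nat) := s + (t - s) * k%:R / n.+1%:R.

Let unifS (s t : R) n k :
  unif_part s t n k.+1 - unif_part s t n k = (t - s) / n.+1%:R.
Proof.
rewrite /unif_part opprD addrACA subrr add0r -mulrBl -mulrBr.
by rewrite -(natr1 k) (addrC k%:R) addrK mulr1.
Qed.

Let unif0 (s t : R) n : unif_part s t n 0 = s.
Proof. by rewrite /unif_part mulr0 mul0r addr0. Qed.

Let unifN (s t : R) n : unif_part s t n n.+1 = t.
Proof. by rewrite /unif_part mulfK ?pnatr_eq0// addrC subrK. Qed.

Let Phi_unif (s t xi : R) n : 0 <= xi -> 0 <= s -> s < t -> t <= T ->
  `|Phi t s xi - Jsum x1 z t n (unif_part s t n) xi| <=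
  c * (t - s) * ((t - s) / n.+1%:R) `^ gam.
Proof.
move=> xi0 s0 st tT.
have ts0 : 0 <= (t - s) / n.+1%:R by rewrite divr_ge0// subr_ge0 ltW.
have := @Phi_Jsum n (unif_part s t n) xi xi0; rewrite unif0 unifN => /(_ s0 tT) H.
apply: le_trans (H _) _ => [i|]; first by rewrite -subr_ge0 unifS.
under eq_bigr do rewrite unifS.
rewrite sumr_const card_ord.
rewrite le_eqVlt; apply/orP; left; apply/eqP.
rewrite -[LHS]mulr_natr.
have : n.+1%:R != 0 :> R by rewrite pnatr_eq0.
by move: (n.+1%:R) => D D0; field.
Qed.

Let harmonic_small (r e : R) : 0 <= r -> 0 < e ->
  exists N, forall n, (N <= n)%N -> r / n.+1%:R < e.
Proof.
move=> r0 e0.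
have : (fun n => r * n.+1%:R^-1) @ \oo --> r * 0.
  by apply: cvgM; [exact: cvg_cst|exact: cvg_harmonic].
rewrite mulr0 => /cvgrPdist_lt/(_ e e0)[N _ HN]; exists N => n Nn.
have := HN n Nn; rewrite sub0r normrN ger0_norm//.
by rewrite mulr_ge0// invr_ge0.
Qed.

Let Phi_cvg (s t xi : R) : 0 <= xi -> 0 <= s -> s < t -> t <= T ->
  (fun n => `|Jsum x1 z t n (unif_part s t n) xi - Phi t s xi|) @ \oo --> 0.
Proof.
move=> xi0 s0 st tT; apply/cvgrPdist_lt => e e0.
have ts0 : 0 <= t - s by rewrite subr_ge0 ltW.
have cts0 : 0 <= c * (t - s) by rewrite mulr_ge0.
have [del del0 Hdel] := powR_small gam0 cts0 e0.
have [N HN] := harmonic_small ts0 del0.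
exists N => // n /= Nn; rewrite sub0r normrN normr_id distrC.
apply: (le_lt_trans (Phi_unif _ xi0 s0 st tT)).
by apply: Hdel; [rewrite divr_ge0|exact/ltW/HN].
Qed.

(* The weight may fail to be integrable, so the Riemann sums converge to Phi
   only pointwise in xi; Fatou's lemma identifies Phi with their limit G in
   the weighted L1 space. *)
Lemma riemann_limit_unique (s t : R) (G : R -> 'M[R]_(1, m)) :
  0 <= s -> s < t -> t <= T -> inL phi gam G ->
  (forall e : R, 0 < e -> exists2 del : R, 0 < del &
    forall (n : nat) (p : nat -> R),
      p 0%N = s -> p n.+1 = t ->
      (forall i, (i <= n)%N -> p i < p i.+1) ->
      (forall i, (i <= n)%N -> p i.+1 - p i < del) ->
      inL phi gam (Jsum x1 z t n p) /\
      Lnrm phi gam (fun xi => G xi - Jsum x1 z t n p xi) < e) ->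
  NL phi gam (fsub G (fun xi => Mint s t (fun v => ecv xi (t - v) *: (y v *m z v)))) = 0%E.
Proof.
move=> s0 st tT LG GJ.
have ts0 : 0 < t - s by rewrite subr_gt0.
pose U n := Jsum x1 z t n (unif_part s t n).
have Ulim (e : R) : 0 < e -> exists N, forall n, (N <= n)%N ->
    inL phi gam (U n) /\ Lnrm phi gam (fun xi => G xi - U n xi) < e.
  move=> e0; have [del del0 Hdel] := GJ e e0.
  have [N HN] := harmonic_small (ltW ts0) del0.
  exists N => n Nn; apply: Hdel; rewrite ?unif0 ?unifN//.
  - by move=> i _; rewrite -subr_gt0 unifS divr_gt0.
  - by move=> i _; rewrite unifS; exact: HN.
(* Here the sums are known to lie in the space only for fine meshes. Shifting by [N0] leaves
   measurable functions, whose pointwise limit Phi is then measurable. *)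
have [N0 HN0] := Ulim 1 ltr01.
have mPhi : mxmeas (Phi t s).
  move=> i j; apply: (@measurable_fun_cvg _ _ _ _ (fun n xi => U (N0 + n)%N xi i j)).
    by move=> n; have [/inL_meas] := HN0 (N0 + n)%N (leq_addr _ _).
  move=> xi; rewrite /= in_itv/= andbT => xi0.
  have := Phi_cvg xi0 s0 st tT; rewrite -(cvg_shiftn N0) => PC.
  apply/cvgrPdist_le => e e0.
  move/cvgrPdist_le : PC => /(_ e e0); apply: filterS => n /=.
  rewrite sub0r normrN normr_id distrC addnC; apply: le_trans.
  by rewrite (le_trans _ (mxnorm_entry _ i j))// !mxE.
apply/eqP; rewrite eq_le NL_ge0 andbT; apply/lee_addgt0Pr => e e0; rewrite add0e.
have [N HN] := Ulim e e0.
pose N' := maxn N N0.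
have UN' n : inL phi gam (U (N' + n)%N) /\
    Lnrm phi gam (fun xi => G xi - U (N' + n)%N xi) < e.
  by apply: HN; rewrite (leq_trans (leq_maxl N N0))// leq_addr.
apply: (NL_fatou phi_meas (F := fun n => U (N' + n)%N)) => //.
- exact: inL_meas LG.
- by move=> n; exact: inL_meas (UN' n).1.
- apply: aeW => xi; rewrite /= in_itv/= andbT => xi0 _.
  have := Phi_cvg (ltW xi0) s0 st tT; rewrite -(cvg_shiftn N').
  rewrite (_ : [sequence _]_n = (fun n => `|U (N' + n)%N xi - Phi t s xi|))//.
  by apply/funext => n; rewrite /= addnC.
- move=> n; have [L1 N1] := UN' n.
  by rewrite (NLE (inLB phi_meas LG L1)) lee_fin ltW.
Qed.

End Smooth_case.

(** * The three claims, with one constant for all z *)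

Theorem theorem3p8 (R : realType) (phi : R -> R)
  (phi_meas : measurable_fun (`]0%R, +oo[ : set R) phi)
  (d m : nat) (T gam : R) (hT : 0 < T) (hgam1 : 1 / 2 < gam) (hgam2 : gam < 1)
  (x : R -> 'M[R]_(1, d)) (x1 : R -> R -> R -> 'M[R]_(1, d))
  (Hx : (Chol gam 0 T x < +oo)%E)
  (Hx1 : inC2 phi gam gam 0 T x1)
  (Hdx1 : forall t u s, 0 <= s -> s <= u -> u <= t -> t <= T ->
            NL phi gam (dlt2 x1 t u s) = 0%E) :
  exists2 c : R, 0 < c &
  forall z : R -> 'M[R]_(d, m), (Chol gam 0 T z < +oo)%E ->
  [/\
   (* (1) well-definedness *)
   sew_dom phi gam (2 * gam) 0 T (hterm x1 z) /\
   inC2 phi gam gam 0 T (Jint phi gam T x1 z),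
   (* (1) smooth case *)
   ((forall v, derivable x v 1) -> continuous (fun v => 'D_1 x v) ->
    (forall v, derivable z v 1) -> continuous (fun v => 'D_1 z v) ->
    (forall t s xi, 0 <= s -> s <= t -> t <= T -> 0 <= xi ->
       x1 t s xi = Mint s t (fun v => ecv xi (t - v) *: 'D_1 x v)) ->
    forall t s, 0 <= s -> s <= t -> t <= T ->
      NL phi gam (fsub (Jint phi gam T x1 z t s)
        (fun xi => Mint s t (fun v => ecv xi (t - v) *: ('D_1 x v *m z v)))) = 0%E),
   (* (2) *)
   (forall l1 l2, 0 <= l1 -> l1 < l2 -> l2 <= T ->
      (N2 phi gam gam l1 l2 (Jint phi gam T x1 z) <=
       c%:E * (Csup l1 l2 z + ((l2 - l1) `^ gam)%:E * Chol gam l1 l2 z))%E) &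
   (* (3) *)
   (forall s t, 0 <= s -> s < t -> t <= T ->
      forall e : R, 0 < e -> exists2 del : R, 0 < del &
        forall (n : nat) (p : nat -> R),
          p 0%N = s -> p n.+1 = t ->
          (forall i, (i <= n)%N -> p i < p i.+1) ->
          (forall i, (i <= n)%N -> p i.+1 - p i < del) ->
          (NL phi gam (fsub (Jint phi gam T x1 z t s) (Jsum x1 z t n p)) < e%:E)%E)].
Proof.
have gam0 : 0 < gam by lra.
have [K K0 x1K] := additive_bound Hx1 Hdx1.
have yc0 := young_const_ge0 d hgam1 K0.
(* The summand 1 keeps the constant positive when d or K is 0. *)
exists (d%:R * K + young_const d gam K + 1).
  by rewrite ltr_wpDl// addr_ge0// mulr_ge0.
move=> z zfin; have [Hz Hz0 [_ zH]] := Chol_bound hT zfin.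
split.
- split.
    exact: (sew_dom_hterm phi_meas hT hgam1 Hx1 Hdx1 x1K Hz0 zH).
  exact: (Jint_inC2 phi_meas hT hgam1 Hx1 Hdx1 K0 x1K Hz0 zH).
- move=> dx cdx dz _ x1E t s s0 st tT.
  have LJ := inL_Jint phi_meas hT hgam1 Hx1 Hdx1 K0 x1K Hz0 zH s0 st tT.
  have cz : continuous z.
    by move=> v; apply: differentiable_continuous; exact/derivable1_diffP.
  have [v0 _ yY] := EVT_max (ltW hT)
    (continuous_subspaceT (fun v => cvg_norm (cdx v))).
  have yY' v : 0 <= v -> v <= T -> `|'D_1 x v| <= `|'D_1 x v0|.
    by move=> v0' vT; apply: yY; rewrite in_itv/= v0'.
  (* The Riemann-sum argument takes s < t; at s = t the classical integral is 0 and [Jint] is null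
     by additivity. *)
  move: st; rewrite le_eqVlt => /orP[/eqP sE|st].
    subst t; have [_] := Jint_additive phi_meas hT hgam1 Hx1 Hdx1 K0 x1K Hz0 zH
      s0 (lexx s) (lexx s) tT.
    rewrite dlt2_diag => J0.
    rewrite (@NL_ext _ _ _ _ _ _ (Jint phi gam T x1 z s s)) ?NLE ?J0// => xi _.
    by rewrite /fsub Mint_diag subr0.
  apply: (riemann_limit_unique phi_meas gam0 (mxcont_continuous cdx)
    (mxcont_continuous cz) (normr_ge0 _) Hz0 yY' zH x1E s0 st tT LJ).
  exact: (Jsum_cvg phi_meas hT hgam1 Hx1 Hdx1 K0 x1K Hz0 zH).
- move=> l1 l2 l10 l12 l2T.
  have zfin' := le_lt_trans (Chol_sub gam z l10 l2T) zfin.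
  have [H H0 [HE zHl]] := Chol_bound l12 zfin'.
  have zsup s : l1 <= s -> s <= l2 -> (`|z s|%:E <= Csup l1 l2 z)%E.
    by move=> ls sl; apply: ereal_sup_ubound; exists s.
  (* Instead of showing that the supremum is finite, its values are separated: at +oo the right-hand
     side is +oo because the constant is positive, and -oo contradicts the lower bound given by z at
     l1. *)
  rewrite HE; case CE : (Csup l1 l2 z) zsup => [X| |] zsup.
  + rewrite [leRHS](_ : _ = ((d%:R * K + young_const d gam K + 1) *
        (X + (l2 - l1) `^ gam * H))%:E)//; apply: N2_le => t s ls st tl.
      apply: (inL_Jint phi_meas hT hgam1 Hx1 Hdx1 K0 x1K Hz0 zH); first exact: le_trans ls.
        exact: ltW.
      exact: le_trans l2T.
    by apply: (Jint_bound phi_meas hT hgam1 Hx1 Hdx1 K0 x1K Hz0 zH l10 l2T H0 zHl).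
  + rewrite addye// gt0_muley ?leey// lte_fin.
    by rewrite ltr_wpDl// addr_ge0// mulr_ge0.
  + by have := zsup l1 (lexx _) (ltW l12).
- move=> s t s0 st tT e e0.
  have [del del0 Hdel] := Jsum_cvg phi_meas hT hgam1 Hx1 Hdx1 K0 x1K Hz0 zH s0 st tT e0.
  exists del => // n p p0 pn pm pd; have [L N] := Hdel n p p0 pn pm pd.
  rewrite NLE ?lte_fin//; apply: inLB => //.
  exact: (inL_Jint phi_meas hT hgam1 Hx1 Hdx1 K0 x1K Hz0 zH s0 (ltW st) tT).
Qed.
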